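(* Let $d\ge2$ and fix $p_0>2$. Suppose that, for every $\nu\in\mathcal M_{p_0}$ and every $x\in C_{p_0}(\nu)$, the spherical Hessian $\operatorname{Hess}F_{p_0,\nu}(x)$ is positive definite. Then there exist $\delta,h>0$ and $N<\infty$ such that every $\mu\in\mathcal M_p$ with $|p-p_0|<\delta$ satisfies $$\operatorname{Hess}F_{p,\mu}(x)\succeq h\,\mathrm{Id}\quad\text{for all }x\in C_p(\mu),\qquad\text{and}\qquad\#\operatorname{supp}\mu\le N.$$
   Context: $\mathbb S^{d-1}$ is the real unit sphere in $\mathbb R^d$. For $p>0$ and a Borel probability measure $\mu$ on $\mathbb S^{d-1}$, $I_p(\mu)=\iint|x\cdot y|^p\,d\mu(x)\,d\mu(y)$; $e(p)$ is the minimum of $I_p$ over Borel probability measures on $\mathbb S^{d-1}$ and $\mathcal M_p$ is the set of minimizers. The potential is $F_{p,\mu}(x)=\int|x\cdot y|^p\,d\mu(y)$, which for $p>2$ is $C^2$ on $\mathbb S^{d-1}$. For $\mu\in\mathcal M_p$ the contact set is $C_p(\mu)=\{x\in\mathbb S^{d-1}:F_{p,\mu}(x)=e(p)\}$. $\operatorname{Hess}F(x)$ is the Riemannian Hessian on the round sphere, a quadratic form on the tangent space $T_x\mathbb S^{d-1}=x^\perp$; for unit $v\perp x$, $\operatorname{Hess}F(x)[v,v]=\frac{d^2}{ds^2}\big|_{s=0}F(x\cos s+v\sin s)$. $\operatorname{Hess}F(x)\succeq h\,\mathrm{Id}$ means $\operatorname{Hess}F(x)[v,v]\ge h$ for all unit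 $v\perp x$. *)

(* Defs.v *)
From HB Require Import structures.
From mathcomp Require Import all_boot all_order all_algebra.
From mathcomp Require Import all_classical all_reals all_analysis.

Set Implicit Arguments.
Unset Strict Implicit.
Unset Printing Implicit Defensive.

Import Order.TTheory GRing.Theory Num.Theory.
Import numFieldNormedType.Exports.

Local Open Scope classical_set_scope.
Local Open Scope ring_scope.

Section SphereEnergy.
Context {R : realType} {d : nat}.
Implicit Types (x y v : 'rV[R]_d) (p : R).

Definition dot x y : R := \sum_(i < d) x 0 i * y 0 i.

(* The library norm on 'rV[R]_d is the sup norm, so the Euclidean one is
   defined here; both induce the same topology. *)
Definition enorm x : R := Num.sqrt (dot x x).

Definition sphere : set 'rV[R]_d := [set x | enorm x = 1].

(* R^d with its Borel sigma-algebra. *)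
Definition borel_rV := g_sigma_algebraType (@open 'rV[R]_d).

(* A Borel probability measure on the sphere is encoded as a Borel probability
   measure on R^d that gives the sphere full mass. *)
Definition sphere_prob : set (probability borel_rV R) :=
  [set mu | mu sphere = 1%E].

Definition potential p (mu : probability borel_rV R) x : R :=
  \int[mu]_(y in sphere) (`|dot x y| `^ p).

Definition energy p (mu : probability borel_rV R) : R :=
  \int[mu]_(x in sphere) (\int[mu]_(y in sphere) (`|dot x y| `^ p)).

Definition min_energy p : R := inf [set energy p mu | mu in sphere_prob].

Definition minimizers p : set (probability borel_rV R) :=
  [set mu | sphere_prob mu /\ energy p mu = min_energy p].

Definition contact_set p (mu : probability borel_rV R) : set 'rV[R]_d :=
  [set x | sphere x /\ potential p mu x = min_energy p].

Definition msupport (mu : probability borel_rV R) : set 'rV[R]_d :=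
  [set x | forall U : set 'rV[R]_d, open U -> U x -> (0 < mu U)%E].

Definition tangent x : set 'rV[R]_d := [set v | dot x v = 0].

(* The geodesic of the unit sphere issued from x with initial velocity v,
   of arbitrary length, in the tangent space at x. For v = 0 it is the constant
   x (0^-1 = 0); for a unit v it is cos s *: x + sin s *: v. *)
Definition geodesic x v (s : R) : 'rV[R]_d :=
  cos (enorm v * s) *: x + (sin (enorm v * s) / enorm v) *: v.

(* The Riemannian Hessian of f at x as a quadratic form, v |-> Hess f(x)[v, v],
   for v in the tangent space at x. *)
Definition Hess (f : 'rV[R]_d -> R) x v : R :=
  derive1n 2 (fun s : R => f (geodesic x v s)) 0.

Definition Hess_posdef (f : 'rV[R]_d -> R) x : Prop :=
  forall v, tangent x v -> v != 0 -> 0 < Hess f x v.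

Definition Hess_ge (f : 'rV[R]_d -> R) x (h : R) : Prop :=
  forall v, tangent x v -> enorm v = 1 -> h <= Hess f x v.

End SphereEnergy.

Arguments borel_rV : clear implicits.
Arguments min_energy {R} d p.

(* Main.v *)
(* The set of minimizers is compact under simultaneous convergence of the
   exponent and the measure: along a free ultrafilter (which replaces the
   extraction of subsequences) minimizers for p_n -> p0 converge weakly to a
   minimizer for p0, and potentials, energies and Hessians pass to the limit.
   If the Hessians at unit tangent vectors of points z_n asymptotically close to
   contact points were not bounded below, the limit would be a contact point of
   a minimizer for p0 with a degenerate Hessian. Two distinct contact points of
   the same minimizer that are close to each other both minimize the potential
   along the geodesic joining them, so by Rolle's theorem applied to the
   derivative the Hessian vanishes at an intermediate point; hence contact
   points are uniformly separated, and they contain the support.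

   Weak limits are constructed by hand: a refining sequence of binary Borel
   partitions turns the limit masses of the cells into a nested family of
   subintervals of [0, 1[, and the limit measure is the law of the induced map
   from [0, 1[ to the sphere. *)
Require Import Defs.
From HB Require Import structures.
From mathcomp Require Import all_boot all_order all_algebra.
From mathcomp Require Import all_classical all_reals all_analysis.
From mathcomp Require Import measurable_realfun ring lra.

Set Implicit Arguments.
Unset Strict Implicit.
Unset Printing Implicit Defensive.

Import Order.TTheory GRing.Theory Num.Theory.
Import numFieldNormedType.Exports.

Local Open Scope classical_set_scope.
Local Open Scope ring_scope.

(** * Limits of real sequences along an ultrafilter *)

Lemma ultra_bounded_cvg (R : realType) (U : set_system nat) (u : nat -> R) (B : R) :
  UltraFilter U -> (forall n, `|u n| <= B) -> exists l : R, u n @[n --> U] --> l.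
Proof.
move=> UU uB.
have [l [_ ucl]] : `[- B, B]%classic `&` cluster (u n @[n --> U]) !=set0.
  apply: (@segment_compact R).
  apply: (@filterS _ U _ setT); last exact: filterT.
  move=> n _ /=.
  by rewrite in_itv /= -ler_norml.
(* An ultrafilter contains the preimage of [V] or that of its complement; the latter would
   contradict that [l] is a cluster point. *)
exists l => V Vl; have [//|UnV] := in_ultra_setVsetC (u @^-1` V) UU.
by have [y [nVy Vy]] := ucl (~` V) V UnV Vl.
Qed.

Lemma cvg_sumr (R : realType) (T : Type) (U : set_system T) (I : Type) (s : seq I)
    (u : I -> T -> R) (l : I -> R) : Filter U ->
  (forall i, u i n @[n --> U] --> l i) ->
  \sum_(i <- s) u i n @[n --> U] --> \sum_(i <- s) l i.
Proof.
move=> FU ul; elim: s => [|i s IHs].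
  by under eq_cvg do rewrite big_nil; rewrite big_nil; exact: cvg_cst.
by under eq_cvg do rewrite big_cons; rewrite big_cons; exact: cvgD.
Qed.

(** * Inner product, unit sphere and its compactness along an ultrafilter *)

Section Sphere.
Context {R : realType} {d : nat}.
Implicit Types (x y v : 'rV[R]_d).

Lemma dotC x y : dot x y = dot y x.
Proof. by apply: eq_bigr => i _; rewrite mulrC. Qed.

Lemma dotDl x y v : dot (x + y) v = dot x v + dot y v.
Proof. by rewrite -big_split; apply: eq_bigr => i _; rewrite mxE mulrDl. Qed.

Lemma dotZl (a : R) x y : dot (a *: x) y = a * dot x y.
Proof. by rewrite /dot mulr_sumr; apply: eq_bigr => i _; rewrite mxE mulrA. Qed.

Lemma dotDr x y v : dot v (x + y) = dot v x + dot v y.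
Proof. by rewrite dotC dotDl !(dotC v). Qed.

Lemma dotZr (a : R) x y : dot x (a *: y) = a * dot x y.
Proof. by rewrite dotC dotZl dotC. Qed.

Lemma dotxx_ge0 x : 0 <= dot x x.
Proof. by apply: sumr_ge0 => i _; rewrite -expr2 sqr_ge0. Qed.

Lemma sphereP x : sphere x <-> dot x x = 1.
Proof.
split=> [x1|x1]; last by rewrite /sphere /= /enorm x1 sqrtr1.
by rewrite -(sqr_sqrtr (dotxx_ge0 x)) -/(enorm x) x1 expr1n.
Qed.

(** Cauchy-Schwarz for unit vectors, read off from the nonnegative squared norms of [x + y] and
    [x - y]. *)
Lemma dot_sphere_le1 x y : dot x x = 1 -> dot y y = 1 -> `|dot x y| <= 1.
Proof.
move=> x1 y1; rewrite ler_norml.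
have := dotxx_ge0 (x + y); have := dotxx_ge0 (x + (-1) *: y).
rewrite !(dotDl, dotDr, dotZl, dotZr) x1 y1 (dotC y x).
by move=> ? ?; apply/andP; split; lra.
Qed.

Lemma coord_sphere_le1 x i : sphere x -> `|x 0 i| <= 1.
Proof.
move=> /sphereP x1; rewrite -(@ler_sqr _ `|x 0 i|) ?nnegrE//.
rewrite expr1n real_normK ?num_real//.
rewrite -x1 /dot (bigD1 i)//= expr2 lerDl.
by apply: sumr_ge0 => j _; rewrite -expr2 sqr_ge0.
Qed.

Context (U : set_system nat) {UU : UltraFilter U}.

(** Working by coordinates reduces every limit of vectors to limits of reals; in finite dimension
    this is norm convergence. *)
Definition cvg_coord (y_ : nat -> 'rV[R]_d) y :=
  forall i, y_ n 0 i @[n --> U] --> y 0 i.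

Lemma cvg_dot (x_ y_ : nat -> 'rV[R]_d) x y :
  cvg_coord x_ x -> cvg_coord y_ y -> dot (x_ n) (y_ n) @[n --> U] --> dot x y.
Proof.
by move=> xx yy; apply: cvg_sumr => i; exact: (cvgM (xx i) (yy i)).
Qed.

Lemma ultra_coord_cvg (x_ : nat -> 'rV[R]_d) (B : R) :
  (forall n i, `|x_ n 0 i| <= B) -> exists x, cvg_coord x_ x.
Proof.
move=> xB; have /choice[l lP] i : exists l : R, x_ n 0 i @[n --> U] --> l.
  by apply: (@ultra_bounded_cvg R U _ B).
by exists (\row_i l i) => i; rewrite mxE.
Qed.

Lemma sphere_cvg (x_ : nat -> 'rV[R]_d) x :
  (forall n, sphere (x_ n)) -> cvg_coord x_ x -> sphere x.
Proof.
move=> xS xx; apply/sphereP; have := cvg_dot xx xx.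
under eq_cvg do rewrite (sphereP _).1//.
by move/cvg_lim => <- //; rewrite lim_cst.
Qed.

Lemma sphere_ultra (x_ : nat -> 'rV[R]_d) :
  (forall n, sphere (x_ n)) -> exists2 x, sphere x & cvg_coord x_ x.
Proof.
move=> xS; have [|x xx] := @ultra_coord_cvg x_ 1.
  by move=> n i; exact: coord_sphere_le1.
by exists x => //; exact: sphere_cvg xx.
Qed.

End Sphere.

(** * Refining binary partition of the space into Borel cells *)

Section Code.
Context {R : realType} {d : nat}.
Implicit Types (x y : 'rV[R]_d).

(* An enumeration of the half-spaces with rational bounds; [code k] packs the
   first [k] of these tests into one natural number, so that the fibres of the
   successive codes form a refining binary tree of Borel cells. *)
Definition bit (j : nat) x : bool :=
  if unpickle j is Some (i, q) then x 0 (i : 'I_d) < ratr (q : rat) else false.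

Fixpoint code (k : nat) x : nat :=
  if k is k'.+1 then ((code k' x).*2 + bit k' x)%N else 0%N.

Lemma code_half k x : (code k.+1 x)./2 = code k x.
Proof. by rewrite /= addnC half_bit_double. Qed.

Lemma code_odd k x : odd (code k.+1 x) = bit k x.
Proof. by rewrite /= oddD odd_double; case: bit. Qed.

Lemma code_lt k x : (code k x < 2 ^ k)%N.
Proof.
elim: k => [//|k IHk] /=; rewrite expnS mul2n.
by case: bit; rewrite ?addn1 ?addn0 ?ltn_Sdouble ?ltn_double.
Qed.

(** Halving a code drops its last test, so a code determines all the earlier ones. *)
Lemma code_le k k' x y :
  (k <= k')%N -> code k' x = code k' y -> code k x = code k y.
Proof.
move=> /subnK <-; elim: (k' - k)%N => [//|n IHn]; rewrite addSn => e.
by apply: IHn; rewrite -code_half e code_half.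
Qed.

Lemma code_bit k j x y : (j < k)%N -> code k x = code k y -> bit j x = bit j y.
Proof. by move=> jk /(code_le jk) e; rewrite -code_odd e code_odd. Qed.

Lemma open_measurable_rV (A : set 'rV[R]_d) :
  open A -> measurable (A : set (borel_rV R d)).
Proof. by move=> oA; exact: sub_sigma_algebra. Qed.

Lemma measurable_coord_lt (i : 'I_d) (r : R) :
  measurable ([set x | x 0 i < r] : set (borel_rV R d)).
Proof.
apply: open_measurable_rV.
apply: (@open_comp _ _ (fun x : 'rV[R]_d => x 0 i) [set t | t < r]) => //.
by move=> x _; exact: coord_continuous.
Qed.

Lemma measurable_bit j : measurable ([set x | bit j x] : set (borel_rV R d)).
Proof.
rewrite /bit; case: unpickle => [[i q]|]; first exact: measurable_coord_lt.
by rewrite (_ : [set _ | _] = set0) // -subset0.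
Qed.

Lemma measurable_code k n :
  measurable ([set x | code k x = n] : set (borel_rV R d)).
Proof.
elim: k n => [|k IHk] n.
  have [->|n0] := eqVneq n 0%N.
    rewrite (_ : [set _ | _] = setT); first exact: measurableT.
    by apply/seteqP; split.
  rewrite (_ : [set _ | _] = set0) // -subset0 => x /= n0'.
  by rewrite -n0' eqxx in n0.
rewrite (_ : [set _ | _] = [set x | code k x = n./2] `&`
   (if odd n then [set x | bit k x] else ~` [set x | bit k x])).
  apply: measurableI; first exact: IHk.
  by case: odd; [|apply: measurableC]; exact: measurable_bit.
apply/seteqP; split=> [x <-|x [/= c b]].
  by split; [exact/esym/code_half|rewrite code_odd; case: ifPn => // /negP].
rewrite c addnC -[RHS]odd_double_half; congr (nat_of_bool _ + _)%N.
by move: b; case: odd => /=; [|move/negP/negbTE].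
Qed.

Lemma measurable_code_pred k (P : pred nat) :
  measurable ([set x | P (code k x)] : set (borel_rV R d)).
Proof.
rewrite (_ : [set _ | _] = \bigcup_(n in [set n | P n]) [set x | code k x = n]).
  by apply: bigcup_measurable => n _; exact: measurable_code.
apply/seteqP; split=> [x Px|x [n Pn /= xn]]; first by exists (code k x).
by rewrite /= xn.
Qed.

Lemma measurable_fun_code k (phi : nat -> R) (D : set (borel_rV R d)) :
  measurable_fun D (fun x : borel_rV R d => phi (code k x)).
Proof.
apply: measurable_funTS => _ A _; rewrite setTI.
rewrite (_ : _ @^-1` _ = [set x | (fun n => phi n \in A) (code k x)]).
  exact: (measurable_code_pred k (fun n => phi n \in A)).
by apply/seteqP; split=> x /=; rewrite inE.
Qed.

Context (U : set_system nat) {UU : UltraFilter U}.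
Context (Ufree : forall N, U [set n | (N <= n)%N]).

(** Continuity of the restriction to the sphere, tested along the single ultrafilter [U]; for a free
    [U] this is equivalent to the usual notion and passes directly to ultralimits. *)
Definition sphere_cont (f : 'rV[R]_d -> R) :=
  forall (y_ : nat -> 'rV[R]_d) y,
  (forall n, sphere (y_ n)) -> cvg_coord U y_ y -> f (y_ n) @[n --> U] --> f y.

(** If the limits differed in some coordinate, a rational strictly between the two values would give
    a half-space test that tells [x_ n] from [y_ n] for [U]-many [n]. *)
Lemma cvg_code_eq (x_ y_ : nat -> 'rV[R]_d) x y :
  (forall n, code n (x_ n) = code n (y_ n)) ->
  cvg_coord U x_ x -> cvg_coord U y_ y -> x = y.
Proof.
wlog suff le : x y x_ y_ / (forall n, code n (x_ n) = code n (y_ n)) ->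
    cvg_coord U x_ x -> cvg_coord U y_ y -> forall i, y 0 i <= x 0 i.
  move=> e xx yy; apply/rowP => i; apply/eqP; rewrite eq_le.
  by rewrite (le y x y_ x_)//= (le x y x_ y_).
move=> e xx yy i; rewrite leNgt; apply/negP => /rat_in_itvoo[q].
rewrite in_itv /= => /andP[xq qy].
have Ux : U [set n | x_ n 0 i < ratr q] := xx i _ (lt_nbhsl xq).
have Uy : U [set n | ratr q < y_ n 0 i] := yy i _ (lt_nbhsr qy).
(* The test on coordinate [i] and bound [q] is number [j], so it is recorded in every code of level
   at least [j.+1]; freeness of [U] provides such an [n]. *)
pose j := pickle (i, q).
have [n [[/= xnq qyn] jn]] := filter_ex (filterI (filterI Ux Uy) (Ufree j.+1)).
have := code_bit jn (e n); rewrite /bit pickleK xnq => /esym.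
by rewrite ltNge (ltW qyn).
Qed.

(** Plays the role of uniform continuity: counterexamples at all levels [k] would form two sequences
    with equal codes, hence with a common limit, where the values of [f] agree. *)
Lemma sphere_cont_code f : sphere_cont f -> forall e, 0 < e ->
  exists k, forall x y, sphere x -> sphere y -> code k x = code k y ->
  `|f x - f y| <= e.
Proof.
move=> cf e e0; apply: contrapT => /forallNP H.
have /choice[xy xyP] k : exists xy : 'rV[R]_d * 'rV[R]_d,
    [/\ sphere xy.1, sphere xy.2, code k xy.1 = code k xy.2 &
        e < `|f xy.1 - f xy.2|].
  apply: contrapT => N; apply: (H k) => x y xS yS xy.
  by rewrite leNgt; apply/negP => exy; apply: N; exists (x, y).
have xyS1 k : sphere (xy k).1 by case: (xyP k).
have xyS2 k : sphere (xy k).2 by case: (xyP k).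
have [x xS xx] := sphere_ultra (UU := UU) xyS1.
have [y yS yy] := sphere_ultra (UU := UU) xyS2.
have xy_eq : x = y by apply: cvg_code_eq xx yy => n; case: (xyP n).
have /cvgrPdist_lt/(_ _ e0) : (f (xy k).1 - f (xy k).2) @[k --> U] --> f x - f y.
  by apply: cvgB; apply: cf => // n; case: (xyP n).
rewrite xy_eq subrr => /filter_ex[n]; rewrite sub0r normrN.
by case: (xyP n) => _ _ _ /ltW; rewrite leNgt => /negP.
Qed.

(** Points where [|f|] exceeds [k] have an ultralimit on the sphere, near which [|f|] is at most its
    limit value plus 1. *)
Lemma sphere_cont_bounded f : sphere_cont f ->
  exists B, forall x, sphere x -> `|f x| <= B.
Proof.
move=> cf; apply: contrapT => /forallNP H.
have /choice[x_ xP] k : exists x, sphere x /\ k%:R < `|f x|.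
  apply: contrapT => N; apply: (H k%:R) => x xS.
  by rewrite leNgt; apply/negP => kx; apply: N; exists x.
have [x xS xx] := @sphere_ultra R d U _ x_ (fun k => proj1 (xP k)).
have /cvgrPdist_lt/(_ _ ltr01) := cf x_ x (fun k => proj1 (xP k)) xx.
set N := Num.trunc (`|f x| + 1).
move=> Un; have [n [/= fn Nn]] := filter_ex (filterI Un (Ufree N.+1)).
have fn1 : `|f (x_ n)| <= `|f x| + 1.
  rewrite -lerBlDl (le_trans (lerB_dist _ _))//.
  by rewrite distrC in fn; exact: ltW.
have := proj2 (xP n); rewrite ltNge => /negP; apply.
rewrite (le_trans fn1)// ltW// (lt_le_trans (truncnS_gt _))//.
by rewrite ler_nat.
Qed.

End Code.

(** * Integrals of bounded functions against a probability measure *)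

Section ProbabilityIntegral.
Context {dT : measure_display} {T : measurableType dT} {R : realType}.
Context (P : probability T R) (D : set T) (mD : measurable D).
Implicit Types (f g : T -> R) (e B : R).

Lemma bounded_integrable f B : measurable_fun D f ->
  (forall x, D x -> `|f x| <= B) -> P.-integrable D (EFin \o f).
Proof.
move=> mf fB; apply: measurable_bounded_integrable => //.
  by rewrite (le_lt_trans (probability_le1 P mD)) ?ltry.
exists B; split; first exact: num_real.
by move=> M BM x Dx; apply: (le_trans (fB x Dx)); exact: ltW.
Qed.

Lemma Rintegral_dist_le f g e : 0 <= e ->
  P.-integrable D (EFin \o f) -> P.-integrable D (EFin \o g) ->
  (forall x, D x -> `|f x - g x| <= e) ->
  `|\int[P]_(x in D) f x - \int[P]_(x in D) g x| <= e.
Proof.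
move=> e0 intf intg fg.
have intfg : P.-integrable D (EFin \o (fun x => f x - g x)).
  exact: (integrableB mD intf intg).
rewrite -RintegralB// (le_trans (le_normr_Rintegral mD intfg))//.
have : \int[P]_(x in D) `|f x - g x| <= \int[P]_(x in D) e.
  apply: le_Rintegral => //; first exact: (integrable_norm intfg).
  exact: finite_measure_integrable_cst.
move=> /le_trans; apply; rewrite Rintegral_cst// ler_piMr//.
rewrite -lee_fin fineK ?probability_le1//.
exact: fin_num_measure.
Qed.

Lemma Rintegral_discrete (g : T -> nat) (phi : nat -> R) N :
  (forall i, measurable (D `&` [set x | g x = i])) ->
  (forall x, D x -> (g x < N)%N) ->
  \int[P]_(x in D) phi (g x) =
  \sum_(i < N) phi i * fine (P (D `&` [set x | g x = i])).
Proof.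
move=> mg gN; rewrite /Rintegral.
pose E i := D `&` [set x | g x = i].
have intE i : P.-integrable D (fun x => (\1_(E i) x)%:E).
  by apply: (integrableS measurableT) => //; exact: integrable_indic (mg i).
rewrite (@eq_integral _ _ _ _ _
    (fun x => (\sum_(i < N) (phi i)%:E * (\1_(E i) x)%:E)%E)); last first.
  move=> x /set_mem Dx.
  rewrite (bigD1 (Ordinal (gN x Dx)))//= big1 ?adde0 => [|i /eqP ig].
    by rewrite indicE mem_set ?mule1.
  rewrite indicE memNset ?mule0// => -[_ /= gi]; apply: ig.
  exact/val_inj.
rewrite integral_sum//; last by move=> i; exact: integrableZl.
rewrite -sum_fine => [|i _]; last first.
  rewrite integralZl// integral_indic//; last exact: mg.
  by rewrite fin_numM// fin_num_measure//; exact: measurableI (mg i) mD.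
apply: eq_bigr => i _; rewrite integralZl// integral_indic//; last exact: mg.
by rewrite setIAC setIid fineM// fin_num_measure//; exact: mg.
Qed.

End ProbabilityIntegral.

(** * Step approximation and integrability of continuous functions on the sphere *)

Section SphereIntegral.
Context {R : realType} {d : nat}.
Local Notation S := (sphere : set (borel_rV R d)).
Context (U : set_system nat) {UU : UltraFilter U}.
Context (Ufree : forall N, U [set n | (N <= n)%N]).

Lemma closed_sphere : closed (@sphere R d).
Proof.
rewrite (_ : sphere = (fun x => dot x x) @^-1` [set 1]); last first.
  by apply/seteqP; split=> x /sphereP.
apply: closed_comp; last exact: closed_eq.
move=> x _.
apply: (@cvg_sumr R _ (nbhs x) _ _ (fun i z => z 0 i * z 0 i)) => i.
by apply: cvgM; exact: coord_continuous.
Qed.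

Lemma measurable_sphere : measurable S.
Proof.
rewrite -[X in measurable X]setCK; apply: measurableC.
by apply: open_measurable_rV; rewrite openC; exact: closed_sphere.
Qed.

(** The default 0 is taken only for cells that miss the sphere; these carry no mass, so its value is
    harmless in the sums below. *)
Definition cell_pt (k i : nat) : 'rV[R]_d :=
  xget 0 [set x | sphere x /\ code k x = i].

Lemma cell_ptP k (x : 'rV[R]_d) : sphere x ->
  sphere (cell_pt k (code k x)) /\ code k (cell_pt k (code k x)) = code k x.
Proof.
move=> xS; rewrite /cell_pt; case: xgetP => [y _ //|/(_ x)].
by move=> /= H; exfalso; apply: H.
Qed.

Lemma sphere_cont_step (f : 'rV[R]_d -> R) : sphere_cont U f ->
  forall e, 0 < e -> exists k, forall k' x, (k <= k')%N -> sphere x ->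
  `|f x - f (cell_pt k' (code k' x))| <= e.
Proof.
move=> cf e e0; have [k kP] := sphere_cont_code Ufree cf e0.
exists k => k' x kk' xS; have [cS ce] := cell_ptP k' xS.
by apply: kP => //; exact/esym/(code_le kk').
Qed.

(** A pointwise limit of functions of a code, the [n]-th one being within [harmonic n] of [f] on the
    sphere. *)
Lemma measurable_sphere_cont (f : 'rV[R]_d -> R) :
  sphere_cont U f -> measurable_fun S f.
Proof.
move=> cf; have /choice[k kP] n := sphere_cont_step cf (@harmonic_gt0 R n).
apply: (@measurable_fun_cvg _ _ _ S
  (fun n x => f (cell_pt (k n) (code (k n) x)))).
  by move=> n; exact: (measurable_fun_code (k n) (f \o cell_pt (k n))).
move=> x xS; apply/cvgrPdist_le => e e0.
have /cvgrPdist_le/(_ _ e0) := @cvg_harmonic R.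
apply: filterS => n; rewrite sub0r normrN ger0_norm ?harmonic_ge0//.
by apply: le_trans; exact: kP.
Qed.

Lemma integrable_sphere_cont (P : probability (borel_rV R d) R) f :
  sphere_cont U f -> P.-integrable S (EFin \o f).
Proof.
move=> cf; have [B fB] := sphere_cont_bounded Ufree cf.
apply: (@bounded_integrable _ _ _ _ _ measurable_sphere f B) => //.
exact: measurable_sphere_cont.
Qed.

End SphereIntegral.

(** * The uniform law on the unit interval *)

Section UniformInterval.
Context {R : realType}.
Local Notation P := (uniform_prob (@ltr01 R)).

Lemma uniform_prob_itvco (a b : R) : 0 <= a -> a <= b -> b <= 1 ->
  P `[a, b[%classic = (b - a)%:E.
Proof.
move=> a0 ab b1; rewrite /uniform_prob (@eq_integral _ _ _ _ _ (cst 1%E)).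
  rewrite integral_cst//= mul1e lebesgue_measure_itv /= lte_fin -EFinB.
  by case: ltgtP ab => // ->; rewrite subrr.
move=> x /set_mem /=; rewrite in_itv /= => /andP[ax xb].
by rewrite /uniform_pdf (le_trans a0 ax) (le_trans (ltW xb) b1) subr0 invr1.
Qed.

End UniformInterval.

(** * Construction of a measure with prescribed cell masses *)

Section TreeMeasure.
Context {R : realType} {d : nat}.
Local Notation S := (sphere : set (borel_rV R d)).
Local Notation P := (uniform_prob (@ltr01 R)).
Local Notation I := (`[0%R, 1%R[%classic : set (measurableTypeR R)).
Context (U : set_system nat) {UU : UltraFilter U}.
Context (Ufree : forall N, U [set n | (N <= n)%N]).

(* [a k i] is the prescribed mass of the union of the cells [code k x < i]; the
   measure realizing these masses is the law of [limit_pt], where [t] in [0, 1[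
   is sent to the limit of the cells whose mass interval contains [t]. *)
Context (a : nat -> nat -> R).
Context (a0 : forall k, a k 0 = 0) (a1 : forall k, a k (2 ^ k) = 1)
  (a_homo : forall k, {homo a k : i j / (i <= j)%N >-> i <= j})
  (a_half : forall k i, a k.+1 i.*2 = a k i)
  (a_cell : forall k i, a k i < a k i.+1 ->
     exists2 x : 'rV[R]_d, sphere x & code k x = i).

Definition leaf (k : nat) (t : R) : nat :=
  xget 0%N [set i | a k i <= t < a k i.+1].

Lemma leaf_uniq k t i j :
  a k i <= t < a k i.+1 -> a k j <= t < a k j.+1 -> i = j.
Proof.
suff le : forall i j, a k i <= t < a k i.+1 -> a k j <= t < a k j.+1 ->
    (i <= j)%N.
  by move=> iP jP; apply/eqP; rewrite eqn_leq !le.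
move=> {}i {}j /andP[it _] /andP[_ tj]; rewrite leqNgt; apply/negP => ji.
by have := le_lt_trans (le_trans (a_homo k ji) it) tj; rewrite ltxx.
Qed.

(** The index is the least [i] with [t < a k i.+1], which exists because [a k (2 ^ k) = 1];
    minimality, or [a0] when [i = 0], gives the lower bound. *)
Lemma leafP k t : I t -> a k (leaf k t) <= t < a k (leaf k t).+1.
Proof.
rewrite /= in_itv /= => /andP[t0 t1]; rewrite /leaf; case: xgetP => // noi.
have ex : exists i, t < a k i.+1.
  by exists (2 ^ k).-1; rewrite prednK ?expn_gt0// a1.
exfalso; case: (ex_minnP ex) => i ti mini; apply: (noi i); rewrite /= ti andbT.
case: i ti mini => [|i] ti mini; first by rewrite a0.
by rewrite leNgt; apply/negP => /mini; rewrite ltnn.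
Qed.

Lemma leafE k t i : I t -> a k i <= t < a k i.+1 -> leaf k t = i.
Proof. by move=> It; apply: leaf_uniq; exact: leafP. Qed.

Lemma leaf_lt k t : I t -> (leaf k t < 2 ^ k)%N.
Proof.
move=> It; have /andP[lt _] := leafP k It; rewrite ltnNge; apply/negP.
move=> /(a_homo k); rewrite a1 => /le_trans/(_ lt) t1.
by move: It; rewrite /= in_itv /= ltNge t1 andbF.
Qed.

(** By [a_half], each mass interval of level [k.+1] lies inside the interval of level [k] whose
    index is half of its own. *)
Lemma leaf_half k t : I t -> (leaf k.+1 t)./2 = leaf k t.
Proof.
move=> It; have /andP[l r] := leafP k.+1 It; apply/esym/leafE => //.
rewrite -!(a_half k); apply/andP; split.
  by apply: (le_trans _ l); apply: a_homo;
    rewrite -{2}(odd_double_half (leaf k.+1 t)) leq_addl.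
apply: (lt_le_trans r); apply: a_homo; rewrite doubleS.
by rewrite ltnS -{1}(odd_double_half (leaf k.+1 t)); case: odd;
  rewrite ?add1n ?add0n.
Qed.

Lemma a_itv k i : 0 <= a k i /\ a k i <= a k i.+1.
Proof. by split; [rewrite -(a0 k)|]; apply: a_homo. Qed.

Lemma leaf_fiber k i : (i < 2 ^ k)%N ->
  I `&` [set t | leaf k t = i] = `[a k i, a k i.+1[%classic.
Proof.
move=> ik; apply/seteqP; split=> [t [It <-]|t /=].
  by rewrite /= in_itv /=; exact: leafP.
rewrite in_itv /= => /andP[it ti].
have It : I t.
  rewrite /= in_itv /= (le_trans _ it) ?(proj1 (a_itv _ _))//=.
  by rewrite (lt_le_trans ti)// -(a1 k) a_homo.
by split=> //; apply: leafE => //; rewrite it.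
Qed.

Lemma leaf_fiber_measurable k i : measurable (I `&` [set t | leaf k t = i]).
Proof.
have [ik|ki] := ltnP i (2 ^ k)%N; first by rewrite leaf_fiber.
rewrite (_ : _ `&` _ = set0)// -subset0 => t [It /= ti].
by have := leaf_lt k It; rewrite ti ltnNge ki.
Qed.

Definition leaf_pt k t : 'rV[R]_d := cell_pt k (leaf k t).

Lemma leaf_ptP k t : I t ->
  sphere (leaf_pt k t) /\ code k (leaf_pt k t) = leaf k t.
Proof.
move=> /(leafP k)/andP[l r]; have [x xS xk] := a_cell (le_lt_trans l r).
by rewrite /leaf_pt -xk; exact: cell_ptP.
Qed.

Lemma code_leaf_pt k n t : I t -> code k (leaf_pt (n + k) t) = leaf k t.
Proof.
move=> It; elim: n k => [|n IHn] k; first by case: (leaf_ptP k It).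
by rewrite -code_half addSnnS IHn leaf_half.
Qed.

(** The value 0 outside [I] is off the sphere, so that the preimage of the sphere is exactly [I]. *)
Definition limit_pt (t : R) : 'rV[R]_d :=
  if pselect (I t) is left It then
    sval (cid2 (@sphere_ultra R d U _ (fun k => leaf_pt k t)
      (fun k => proj1 (leaf_ptP k It))))
  else 0.

Lemma limit_ptP t : I t ->
  sphere (limit_pt t) /\ cvg_coord U (fun k => leaf_pt k t) (limit_pt t).
Proof.
by move=> It; rewrite /limit_pt; case: pselect => // ?; case: cid2.
Qed.

Lemma limit_pt_out t : ~ I t -> limit_pt t = 0.
Proof. by rewrite /limit_pt; case: pselect. Qed.

Lemma sphere0 : ~ sphere (0 : 'rV[R]_d).
Proof.
move=> /sphereP; rewrite /dot big1 => [/eqP|i _]; last by rewrite mxE mul0r.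
by rewrite eq_sym oner_eq0.
Qed.

Lemma limit_pt_sphere : limit_pt @^-1` sphere = I.
Proof.
apply/seteqP; split=> t /=; last by move=> /limit_ptP[].
by apply: contraPP => /limit_pt_out ->; exact: sphere0.
Qed.

(** All leaf points of [t] deeper than [k] share its code of level [k], so their values under [f]
    are within [e] of each other; this closed condition survives the limit. The threshold depends on
    [f] and [e] only, hence the uniformity in [t]. *)
Lemma limit_pt_approx f (e : R) : sphere_cont U f -> 0 < e ->
  exists K, forall k t, (K <= k)%N -> I t ->
  `|f (limit_pt t) - f (leaf_pt k t)| <= e.
Proof.
move=> cf e0; have [K KP] := sphere_cont_code Ufree cf e0.
exists K => k t Kk It; have [XS Xt] := limit_ptP It.
have cv : f (leaf_pt n t) @[n --> U] --> f (limit_pt t).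
  by apply: cf => // n; exact: proj1 (leaf_ptP n It).
apply: (@closed_cvg _ R^o U _ _ (fun z => `|z - f (leaf_pt k t)| <= e)) cv.
  apply: (@closed_comp R^o R^o (fun z => `|z - f (leaf_pt k t)|) [set z | z <= e]).
    by move=> z _; apply: cvg_norm; apply: cvgB; [exact: cvg_id|exact: cvg_cst].
  exact: closed_le.
apply: filterS (Ufree k) => n /= kn; apply: KP.
- exact: proj1 (leaf_ptP n It).
- exact: proj1 (leaf_ptP k It).
apply: (code_le Kk); rewrite (proj2 (leaf_ptP k It)).
by rewrite -(subnK kn) code_leaf_pt.
Qed.

Lemma sphere_cont_coord i : sphere_cont U (fun x : 'rV[R]_d => x 0 i).
Proof. by move=> y_ y _; exact. Qed.

(** Inside [I], the preimage of an open set is the countable union of the mass intervals it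
    contains, since a deep enough interval around [t] is sent close to [limit_pt t]. Outside [I] the
    map is constant. *)
Lemma measurable_limit_pt :
  measurable_fun setT (limit_pt : measurableTypeR R -> borel_rV R d).
Proof.
apply: (@measurability _ _ _ (borel_rV R d) setT limit_pt (@open 'rV[R]_d)) => //.
move=> _ [V oV <-]; rewrite setTI.
pose Q k i := `[a k i, a k i.+1[%classic `<=` limit_pt @^-1` V.
have -> : limit_pt @^-1` V =
  (\bigcup_k \bigcup_(i in Q k) `[a k i, a k i.+1[%classic) `|`
  (~` I `&` [set t | V 0]); last first.
  apply: measurableU; first by do 2 apply: bigcup_measurable => ? _.
  apply: measurableI; first exact: measurableC.
  have [V0|V0] := pselect (V 0).
    by rewrite (_ : [set _ | _] = setT)//; apply/seteqP; split.
  by rewrite (_ : [set _ | _] = set0)// -subset0.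
apply/seteqP; split=> [t Vt|t [[k _ [i Qki it]]|[It Vt]]]; last first.
- by rewrite /= limit_pt_out.
- exact: Qki.
have [It|nIt] := pselect (I t); last first.
  by right; split=> //=; rewrite -(limit_pt_out nIt).
left; have /nbhs_ballP[r /= r0 rV] := oV _ Vt.
(* Two points with the same leaf are each within [r / 4] of the leaf point in every coordinate,
   hence within [r / 2 < r] of each other. *)
have r40 : 0 < r / 4 by rewrite divr_gt0.
have /choice[K KP] i := limit_pt_approx (@sphere_cont_coord i) r40.
pose k := (\max_i K i)%N.
exists k => //; exists (leaf k t); last by rewrite /= in_itv /=; exact: leafP.
move=> s; rewrite -leaf_fiber; last exact: leaf_lt.
move=> [Is /= st]; apply: rV; split=> // i j; rewrite /ball /= (ord1 i).
have Kk : (K j <= k)%N by exact: leq_bigmax.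
have := KP j k s Kk Is; have := KP j k t Kk It.
rewrite /leaf_pt st !ler_norml => /andP[? ?] /andP[? ?].
by rewrite ltr_norml; apply/andP; split; lra.
Qed.

HB.instance Definition _ := isMeasurableFun.Build _ _ _ _
  (limit_pt : measurableTypeR R -> borel_rV R d) measurable_limit_pt.

Definition tree_prob : probability (borel_rV R d) R :=
  distribution P (limit_pt : {mfun measurableTypeR R >-> borel_rV R d}).

Lemma tree_prob_sphere : sphere_prob tree_prob.
Proof.
suff : P (limit_pt @^-1` sphere) = 1%E by [].
by rewrite limit_pt_sphere uniform_prob_itvco// subr0.
Qed.

Lemma measurable_sphere_cont_patch (f : 'rV[R]_d -> R) : sphere_cont U f ->
  measurable_fun setT ((f : borel_rV R d -> R) \_ S).
Proof.
move=> cf; apply: (measurable_restrictT (f : borel_rV R d -> R)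
  (@measurable_sphere R d)).1.
exact: measurable_sphere_cont cf.
Qed.

Lemma limit_pt_patch (f : 'rV[R]_d -> R) :
  ((f : borel_rV R d -> R) \_ S) \o limit_pt = (f \o limit_pt) \_ I.
Proof.
rewrite -limit_pt_sphere; apply/funext => t; rewrite /= !patchE.
by congr (if _ then _ else _); apply/idP/idP; rewrite !inE.
Qed.

Lemma measurable_limit_pt_comp (f : 'rV[R]_d -> R) : sphere_cont U f ->
  measurable_fun I (f \o limit_pt).
Proof.
move=> cf; apply/measurable_restrictT => //; rewrite -limit_pt_patch.
exact: (measurableT_comp (measurable_sphere_cont_patch cf) measurable_limit_pt).
Qed.

Lemma integrable_limit_pt_comp (f : 'rV[R]_d -> R) : sphere_cont U f ->
  P.-integrable I (EFin \o (f \o limit_pt)).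
Proof.
move=> cf; have [B fB] := sphere_cont_bounded Ufree cf.
apply: (@bounded_integrable _ _ _ _ _ _ _ B) => //.
  exact: measurable_limit_pt_comp.
by move=> t /limit_ptP[/fB].
Qed.

Lemma measurable_leaf (phi : nat -> R) k :
  measurable_fun I (fun t => phi (leaf k t)).
Proof.
move=> _ Y mY.
rewrite (_ : _ `&` _ = \bigcup_(i in phi @^-1` Y) (I `&` [set t | leaf k t = i])).
  by apply: bigcup_measurable => i _; exact: leaf_fiber_measurable.
apply/seteqP; split=> [t [It /= Yt]|t [i Yi [It /= ti]]].
  by exists (leaf k t).
by split=> //=; rewrite ti.
Qed.

(** Change of variables for an image measure, applied to [f] extended by 0 off the sphere because
    [f] is only known to be measurable there. *)
Lemma Rintegral_tree_prob (f : 'rV[R]_d -> R) : sphere_cont U f ->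
  \int[tree_prob]_(x in sphere) f x = \int[P]_(t in I) f (limit_pt t).
Proof.
move=> cf; have intf := integrable_limit_pt_comp cf.
rewrite Rintegral_mkcond [RHS]Rintegral_mkcond /Rintegral; congr fine.
pose g := (f : borel_rV R d -> R) \_ S.
have mg : measurable_fun setT (EFin \o g).
  by apply/measurable_EFinP; exact: measurable_sphere_cont_patch.
have intg : P.-integrable setT ((EFin \o g) \o limit_pt).
  rewrite (_ : _ \o limit_pt = (EFin \o (f \o limit_pt)) \_ I).
    by apply/integrable_restrict => //; rewrite setTI.
  by rewrite restrict_EFin -limit_pt_patch.
rewrite [LHS](integral_distribution mg intg).
by apply: eq_integral => t _; rewrite /= -limit_pt_patch.
Qed.

Lemma Rintegral_tree_prob_approx (f : 'rV[R]_d -> R) (e : R) :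
  sphere_cont U f -> 0 < e -> exists K, forall k, (K <= k)%N ->
  `|\int[tree_prob]_(x in sphere) f x -
    \sum_(i < 2 ^ k) f (cell_pt k i) * (a k i.+1 - a k i)| <= e.
Proof.
move=> cf e0; have [K KP] := limit_pt_approx cf e0.
have [B fB] := sphere_cont_bounded Ufree cf.
exists K => k Kk; rewrite Rintegral_tree_prob//.
pose phi i := f (cell_pt k i).
have phi_int : \int[P]_(t in I) phi (leaf k t) =
    \sum_(i < 2 ^ k) phi i * (a k i.+1 - a k i).
  rewrite (Rintegral_discrete P (measurable_itv _) phi
    (leaf_fiber_measurable k) (@leaf_lt k)).
  apply: eq_bigr => i _; rewrite leaf_fiber// [X in fine X]uniform_prob_itvco//.
  - exact: proj1 (a_itv _ _).
  - exact: proj2 (a_itv _ _).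
  - by rewrite -(a1 k) a_homo.
rewrite -phi_int; apply: Rintegral_dist_le => //.
- exact: ltW.
- exact: integrable_limit_pt_comp.
- apply: (@bounded_integrable _ _ _ _ _ _ _ B) => //.
    exact: measurable_leaf.
  by move=> t /(leaf_ptP k)[/fB].
- by move=> t It; exact: KP.
Qed.

End TreeMeasure.

(** * Weak compactness of probability measures on the sphere *)

Lemma cvg_le_filter (R : realType) (T : Type) (F : set_system T) (u v : T -> R)
    {FF : ProperFilter F} (l m : R) :
  u n @[n --> F] --> l -> v n @[n --> F] --> m -> (forall n, u n <= v n) ->
  l <= m.
Proof.
move=> ul vm uv; rewrite -subr_ge0.
apply: (@closed_cvg _ R^o F FF (fun n => v n - u n) (fun z => 0 <= z)).
- exact: closed_ge.
- by apply: nearW => n; rewrite subr_ge0.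
- exact: cvgB.
Qed.

Section WeakLimit.
Context {R : realType} {d : nat}.
Local Notation S := (sphere : set (borel_rV R d)).
Context (U : set_system nat) {UU : UltraFilter U}.
Context (Ufree : forall N, U [set n | (N <= n)%N]).

Definition weak_cvg (mu : nat -> probability (borel_rV R d) R)
    (nu : probability (borel_rV R d) R) := forall f, sphere_cont U f ->
  \int[mu n]_(x in sphere) f x @[n --> U] --> \int[nu]_(x in sphere) f x.

(** The cumulative cell masses of [mu n] converge along [U], and their limits inherit what the tree
    construction requires. Integrals are then compared through step sums at one fixed level, which
    are finite combinations of cell masses. *)
Lemma weak_compact (mu : nat -> probability (borel_rV R d) R) :
  (forall n, sphere_prob (mu n)) ->
  exists2 nu : probability (borel_rV R d) R, sphere_prob nu & weak_cvg mu nu.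
Proof.
move=> muS; pose A k i : set (borel_rV R d) := S `&` [set x | (code k x < i)%N].
have mA k i : measurable (A k i).
  apply: measurableI; first exact: measurable_sphere.
  exact: (measurable_code_pred k (fun n => (n < i)%N)).
have finA n k i : mu n (A k i) \is a fin_num by exact: fin_num_measure.
pose m n k i := fine (mu n (A k i)).
have m_le1 n k i : `|m n k i| <= 1.
  rewrite ger0_norm ?fine_ge0// -lee_fin fineK//.
  exact: probability_le1.
have /choice[a' a'P] ki : exists l : R, m n ki.1 ki.2 @[n --> U] --> l.
  by apply: (@ultra_bounded_cvg R U _ 1) => n; exact: m_le1.
pose a k i := a' (k, i).
have aP k i : m n k i @[n --> U] --> a k i by exact: (a'P (k, i)).
have a_eq k i k' i' : A k i = A k' i' -> a k i = a k' i'.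
  move=> e; apply/eqP; rewrite eq_le.
  rewrite (cvg_le_filter (aP k i) (aP k' i')) => [|n]; last by rewrite /m e.
  by rewrite (cvg_le_filter (aP k' i') (aP k i)) => [|n]; last rewrite /m e.
have a0 k : a k 0%N = 0.
  have A0 : A k 0%N = set0 by rewrite -subset0 => x [].
  rewrite -(cvg_lim _ (aP k 0%N))// /m A0.
  by under eq_fun do rewrite measure0 /=; rewrite lim_cst.
have a1 k : a k (2 ^ k)%N = 1.
  have AS : A k (2 ^ k)%N = S.
    by apply/seteqP; split=> [x []//|x xS]; split=> //=; exact: code_lt.
  rewrite -(cvg_lim _ (aP k _))// /m AS.
  by under eq_fun do rewrite muS /=; rewrite lim_cst.
have a_homo k : {homo a k : i j / (i <= j)%N >-> i <= j}.
  move=> i j ij; apply: (cvg_le_filter (aP k i) (aP k j)) => n.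
  rewrite /m fine_le// le_measure ?inE// => x [xS /= xi]; split=> //=.
  exact: leq_trans ij.
have a_half k i : a k.+1 i.*2 = a k i.
  apply: a_eq; apply/seteqP; split=> x [xS xi]; split=> //; move: xi => /=.
    by case: bit; rewrite ?addn1 ?addn0 ?ltn_Sdouble ?ltn_double.
  by case: bit; rewrite ?addn1 ?addn0 ?ltn_Sdouble ?ltn_double.
(* For a cell that misses the sphere, [A k i] and [A k i.+1] coincide, and so do the limit
   masses. *)
have a_cell k i : a k i < a k i.+1 ->
    exists2 x : 'rV[R]_d, sphere x & code k x = i.
  move=> ai; apply: contrapT => /forall2NP H.
  suff e : A k i = A k i.+1 by rewrite (a_eq _ _ _ _ e) ltxx in ai.
  apply/seteqP; split=> x [xS /= xi]; split=> //=; first exact: ltnW.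
  rewrite ltn_neqAle -ltnS xi andbT; apply/eqP => e.
  by case: (H x).
pose nu : probability (borel_rV R d) R :=
  @tree_prob R d U UU Ufree a a0 a1 a_homo a_half a_cell.
exists nu; first exact: tree_prob_sphere.
move=> f cf; apply/cvgrPdist_le => e e0.
(* One third for each step approximation, under [mu n] and under [nu], and one for the convergence
   of the step sums. *)
have e30 : 0 < e / 3 by rewrite divr_gt0.
have [K KP] := Rintegral_tree_prob_approx Ufree a0 a1 a_homo a_half a_cell cf e30.
have [K' K'P] := sphere_cont_step Ufree cf e30.
pose k := maxn K K'.
pose Sn b := \sum_(i < 2 ^ k) f (cell_pt k i) * (b k i.+1 - b k i).
have SnP : Sn (m n) @[n --> U] --> Sn a.
  by apply: cvg_sumr => i; apply: cvgM; [exact: cvg_cst|exact: cvgB].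
have cellE n (i : nat) :
    fine (mu n (S `&` [set x | code k x = i])) = m n k i.+1 - m n k i.
  rewrite /m -fineB//; congr fine.
  rewrite (_ : S `&` _ = A k i.+1 `\` A k i).
    rewrite measureD//; last by rewrite ltey_eq finA.
    congr (_ - mu n _)%E; apply/setIidPr => x [xS /= xi]; split=> //=.
    exact: ltnW.
  apply/seteqP; split=> [x [xS /= <-]|x [[xS /= xi] nxi]].
    by split=> [|[_ /=]]; [split=> /=|rewrite ltnn].
  split=> //=; apply/eqP; rewrite eqn_leq -ltnS xi /= leqNgt.
  by apply/negP => H; apply: nxi.
have intE n : `|\int[mu n]_(x in sphere) f x - Sn (m n)| <= e / 3.
  have [B fB] := sphere_cont_bounded Ufree cf.
  pose phi i := f (cell_pt k i).
  have -> : Sn (m n) = \int[mu n]_(x in S) phi (code k x).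
    rewrite (Rintegral_discrete (mu n) (@measurable_sphere R d) phi
      (N := 2 ^ k)) => [|i|x _].
    - by apply: eq_bigr => i _; rewrite cellE.
    - by apply: measurableI; [exact: measurable_sphere|exact: measurable_code].
    - exact: code_lt.
  apply: (Rintegral_dist_le (@measurable_sphere R d)).
  - exact: ltW.
  - exact: integrable_sphere_cont cf.
  - apply: (@bounded_integrable _ _ _ _ _ (@measurable_sphere R d) _ B).
      exact: measurable_fun_code.
    by move=> x /(cell_ptP k)[/fB].
  - by move=> x xS; apply: K'P => //; rewrite leq_maxr.
have nuE : `|\int[nu]_(x in sphere) f x - Sn a| <= e / 3.
  by apply: KP; rewrite leq_maxl.
have /cvgrPdist_le/(_ _ e30) := SnP; apply: filterS => n nP.
have := intE n; move: nuE nP; rewrite !ler_norml => /andP[? ?] /andP[? ?] /andP[? ?].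
by apply/andP; split; lra.
Qed.

End WeakLimit.

(** * Powers, potentials, energies and minimizers under limits *)

Lemma cvg_powR (R : realType) (T : Type) (F : set_system T) {FF : ProperFilter F}
    (u p : T -> R) (a q : R) : 0 < q -> (forall n, 0 <= u n) ->
  u n @[n --> F] --> a -> p n @[n --> F] --> q ->
  u n `^ p n @[n --> F] --> a `^ q.
Proof.
move=> q0 u0 ua pq.
have a0 : 0 <= a.
  by apply: (cvg_le_filter (F := F) (cvg_cst (0 : R)) ua).
have [a0'|an0] := eqVneq a 0; last first.
  have apos : 0 < a by rewrite lt_neqAle eq_sym an0.
  have : expR (p n * ln (u n)) @[n --> F] --> a `^ q.
    rewrite /powR (negbTE an0); apply: continuous_cvg; first exact: continuous_expR.
    apply: cvgM => //; apply: continuous_cvg => //.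
    exact: continuous_ln.
  apply: cvg_trans; apply: near_eq_cvg.
  have /cvgr_gt/(_ _ apos) := ua; apply: filterS => n un0.
  by rewrite /powR gt_eqF.
rewrite a0' powR0 ?gt_eqF//; apply/cvgrPdist_le => e e0.
(* Eventually [u n < c] and [p n > q / 2]; as [c <= 1], lowering the exponent to [q / 2] only
   increases the power, and the second term of the minimum makes the result at most [e]. *)
pose c := Num.min (1 : R) (e `^ (2 / q)).
have c0 : 0 < c by rewrite lt_min ltr01 powR_gt0.
have q2 : q / 2 < q by rewrite ltr_pdivrMr// ltr_pMr// ltr1n.
move: ua; rewrite a0' => /cvgr_lt/(_ _ c0) Hu.
move/cvgr_gt/(_ _ q2) : pq => Hp.
apply: filterS (filterI Hu Hp) => n [].
rewrite lt_min => /andP[u1 ue] qp.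
rewrite sub0r normrN ger0_norm ?powR_ge0//.
have [un0|un0] := eqVneq (u n) 0.
  by rewrite un0 powR0 ?ltW// gt_eqF// (lt_trans _ qp)// divr_gt0.
have un : 0 < u n <= 1 by rewrite lt_neqAle eq_sym un0 u0 ltW.
rewrite (le_trans (ger_powR un (ltW qp)))//.
have -> : e = (e `^ (2 / q)) `^ (q / 2).
  by rewrite -powRrM mulrA divfK ?gt_eqF// divff// powRr1// ltW.
by rewrite ge0_ler_powR ?nnegrE ?powR_ge0// ltW// divr_gt0.
Qed.

Section Potential.
Context {R : realType} {d : nat}.
Local Notation S := (sphere : set (borel_rV R d)).
Local Notation prob := (probability (borel_rV R d) R).
Implicit Types (p e : R) (x y : 'rV[R]_d).
Context (U : set_system nat) {UU : UltraFilter U}.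
Context (Ufree : forall N, U [set n | (N <= n)%N]).

Lemma weak_cvg_cst (mu : prob) : weak_cvg U (fun=> mu) mu.
Proof. by move=> f _; exact: cvg_cst. Qed.

(** Compactness turns convergence along moving points into uniform convergence: at the limit of a
    sequence of violating points, both [f_ n (y_ n)] and [f (y_ n)] tend to [f y]. *)
Lemma sphere_unif_cvg (f_ : nat -> 'rV[R]_d -> R) f :
  sphere_cont U f ->
  (forall (y_ : nat -> 'rV[R]_d) y, (forall n, sphere (y_ n)) ->
     cvg_coord U y_ y -> f_ n (y_ n) @[n --> U] --> f y) ->
  forall e, 0 < e -> U [set n | forall y, sphere y -> `|f_ n y - f y| <= e].
Proof.
move=> cf ff e e0; have [//|nU] := in_ultra_setVsetC
  [set n | forall y, sphere y -> `|f_ n y - f y| <= e] UU.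
have [n0 /= /existsNP[x0 /not_implyP[x0S _]]] := filter_ex nU.
(* [y_ n] violates the bound whenever some point of the sphere does; otherwise it is the arbitrary
   point [x0]. *)
have /choice[y_ yP] (n : nat) : exists y, sphere y /\
    ((exists2 z, sphere z & e < `|f_ n z - f z|) -> e < `|f_ n y - f y|).
  have [[z zS ez]|N] := pselect (exists2 z, sphere z & e < `|f_ n z - f z|).
    by exists z.
  by exists x0.
have [y yS yy] := sphere_ultra (fun n => proj1 (yP n)).
have : f_ n (y_ n) - f (y_ n) @[n --> U] --> f y - f y.
  by apply: cvgB; [apply: ff|apply: cf] => // n; exact: proj1 (yP n).
rewrite subrr => /cvgrPdist_lt/(_ _ e0) Ue.
have [n [/= /existsNP[z /not_implyP[zS /negP]]]] := filter_ex (filterI nU Ue).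
rewrite -ltNge sub0r normrN => ez.
by rewrite ltNge ltW//; apply: (proj2 (yP n)); exists z.
Qed.

(** Uniform convergence handles the change of integrand, weak convergence the change of measure.
    This lets exponent, base point and measure vary together. *)
Lemma weak_ccvg (mu : nat -> prob) (nu : prob) (f_ : nat -> 'rV[R]_d -> R) f :
  weak_cvg U mu nu -> (forall n, sphere_cont U (f_ n)) -> sphere_cont U f ->
  (forall (y_ : nat -> 'rV[R]_d) y, (forall n, sphere (y_ n)) ->
     cvg_coord U y_ y -> f_ n (y_ n) @[n --> U] --> f y) ->
  \int[mu n]_(x in sphere) f_ n x @[n --> U] --> \int[nu]_(x in sphere) f x.
Proof.
move=> munu cf_ cf ff; apply/cvgrPdist_le => e e0.
have e20 : 0 < e / 2 by rewrite divr_gt0.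
have /cvgrPdist_le/(_ _ e20) H1 := munu f cf.
have H2 := sphere_unif_cvg cf ff e20.
apply: filterS (filterI H1 H2) => n [/= h1 h2].
have h3 : `|\int[mu n]_(x in sphere) f_ n x - \int[mu n]_(x in sphere) f x| <= e / 2.
  apply: (Rintegral_dist_le (@measurable_sphere R d)).
  - exact: ltW.
  - exact: integrable_sphere_cont (cf_ n).
  - exact: integrable_sphere_cont cf.
  - exact: h2.
move: h1 h3; rewrite !ler_norml => /andP[? ?] /andP[? ?].
by apply/andP; split; lra.
Qed.

Lemma kernel_cvg (p_ : nat -> R) (p : R) (x_ y_ : nat -> 'rV[R]_d) x y : 0 < p ->
  p_ n @[n --> U] --> p -> cvg_coord U x_ x -> cvg_coord U y_ y ->
  `|dot (x_ n) (y_ n)| `^ p_ n @[n --> U] --> `|dot x y| `^ p.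
Proof.
move=> p0 pp xx yy; apply: cvg_powR => //.
by apply: cvg_norm; exact: cvg_dot.
Qed.

Lemma cvg_coord_cst (x : 'rV[R]_d) : cvg_coord U (fun=> x) x.
Proof. by move=> i; exact: cvg_cst. Qed.

Lemma sphere_cont_kernel p (x : 'rV[R]_d) : 0 < p ->
  sphere_cont U (fun y => `|dot x y| `^ p).
Proof.
by move=> p0 y_ y _ yy; apply: kernel_cvg => //; [exact: cvg_cst|exact: cvg_coord_cst].
Qed.

Lemma potential_cvg (mu : nat -> prob) (nu : prob) (p_ : nat -> R) (p : R)
    (x_ : nat -> 'rV[R]_d) x :
  weak_cvg U mu nu -> (forall n, 0 < p_ n) -> 0 < p ->
  p_ n @[n --> U] --> p -> cvg_coord U x_ x ->
  potential (p_ n) (mu n) (x_ n) @[n --> U] --> potential p nu x.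
Proof.
move=> munu p_0 p0 pp xx; apply: (weak_ccvg munu).
- by move=> n; exact: sphere_cont_kernel.
- exact: sphere_cont_kernel.
- by move=> y_ y _ yy; exact: kernel_cvg.
Qed.

Lemma sphere_cont_potential p (mu : prob) : 0 < p ->
  sphere_cont U (potential p mu).
Proof.
move=> p0 y_ y _ yy; apply: (@potential_cvg (fun=> mu) mu (fun=> p)) => //.
  exact: weak_cvg_cst.
exact: cvg_cst.
Qed.

Lemma energy_cvg (mu : nat -> prob) (nu : prob) (p_ : nat -> R) (p : R) :
  weak_cvg U mu nu -> (forall n, 0 < p_ n) -> 0 < p ->
  p_ n @[n --> U] --> p ->
  energy (p_ n) (mu n) @[n --> U] --> energy p nu.
Proof.
move=> munu p_0 p0 pp.
apply: (@weak_ccvg mu nu (fun n => potential (p_ n) (mu n)) (potential p nu)) => //.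
- by move=> n; exact: sphere_cont_potential.
- exact: sphere_cont_potential.
- by move=> y_ y _ yy; exact: potential_cvg.
Qed.

Lemma energy_ge0 p (mu : prob) : 0 <= energy p mu.
Proof.
by apply: Rintegral_ge0 => x _; apply: Rintegral_ge0 => y _; exact: powR_ge0.
Qed.

Lemma min_energy_le p (mu : prob) : sphere_prob mu -> min_energy d p <= energy p mu.
Proof.
move=> muS; apply: ge_inf; last by exists mu.
by exists 0 => _ [sigma _ <-]; exact: energy_ge0.
Qed.

Lemma minimizersP p (mu : prob) : sphere_prob mu ->
  (forall sigma : prob, sphere_prob sigma -> energy p mu <= energy p sigma) ->
  minimizers p mu.
Proof.
move=> muS mumin; split=> //; apply/eqP; rewrite eq_le min_energy_le// andbT.
apply: lb_le_inf; first by exists (energy p mu), mu.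
by move=> _ [sigma sS <-]; exact: mumin.
Qed.

(** Each competitor [sigma] is kept fixed while the exponent varies, and the inequality between its
    energy and that of [mu n] passes to the limit. *)
Lemma minimizers_cvg (mu : nat -> prob) (nu : prob) (p_ : nat -> R) (p : R) :
  weak_cvg U mu nu -> sphere_prob nu -> (forall n, 0 < p_ n) -> 0 < p ->
  p_ n @[n --> U] --> p -> (forall n, minimizers (p_ n) (mu n)) ->
  minimizers p nu /\ min_energy d (p_ n) @[n --> U] --> min_energy d p.
Proof.
move=> munu nuS p_0 p0 pp mumin.
have numin : minimizers p nu.
  apply: minimizersP => // sigma sS.
  have H1 := energy_cvg munu p_0 p0 pp.
  have H2 := energy_cvg (@weak_cvg_cst sigma) p_0 p0 pp.
  apply: (cvg_le_filter H1 H2) => n.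
  by rewrite (proj2 (mumin n)) min_energy_le.
split=> //; rewrite -(proj2 numin).
have := energy_cvg munu p_0 p0 pp.
by under eq_fun do rewrite (proj2 (mumin _)).
Qed.

End Potential.

(** * Derivatives of powers of absolute values *)

Lemma is_derive1M (R : realType) (f g : R -> R) (x a b : R) :
  is_derive x 1 f a -> is_derive x 1 g b ->
  is_derive x 1 (fun t => f t * g t) (a * g x + f x * b).
Proof.
move=> fa gb; have H := @is_deriveM _ _ _ _ _ _ _ _ fa gb.
have -> : a * g x + f x * b = f x *: (b : R^o) + g x *: (a : R^o).
  by rewrite addrC [a * _]mulrC.
exact: H.
Qed.

(** Away from 0 this is the product rule; at 0 the difference quotient is |h|^q, which tends to 0.
    With [q = p - 2] it serves for both derivatives of |t|^p. *)
Lemma is_derive_mul_normr_powR (R : realType) (q u : R) : 0 < q ->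
  is_derive u 1 (fun t => t * `|t| `^ q) ((q + 1) * `|u| `^ q).
Proof.
move=> q0; have [u0|u0|->] := ltgtP u 0.
- apply: (@near_eq_is_derive R R^o R^o (fun t => t * (- t) `^ q)).
    near=> t; rewrite ltr0_norm//; near: t; exact: lt_nbhsl.
  have H : is_derive u 1 (fun t : R => (- t) `^ q) (- (q * (- u) `^ (q - 1))).
    have d1 : is_derive (- u) 1 (@powR R ^~ q) (q * (- u) `^ (q - 1)).
      by apply: is_derive1_powR; rewrite oppr_gt0.
    have d2 : is_derive u 1 (@GRing.opp R) (- 1) by exact: is_deriveNid.
    by have := is_derive1_comp d1 d2; rewrite mulrN1.
  have := is_derive1M (@is_derive_id R R^o u 1) H.
  rewrite (_ : _ + _ = (q + 1) * `|u| `^ q)//.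
  rewrite ltr0_norm// mul1r mulrN -mulNr mulrCA mulr_powRB1 ?oppr_ge0 ?ltW//.
  by rewrite mulrDl mul1r addrC.
- apply: (@near_eq_is_derive R R^o R^o (fun t => t * t `^ q)).
    near=> t; rewrite gtr0_norm//; near: t; exact: lt_nbhsr.
  have := is_derive1M (@is_derive_id R R^o u 1) (is_derive1_powR q u0).
  rewrite (_ : _ + _ = (q + 1) * `|u| `^ q)//.
  by rewrite gtr0_norm// mul1r mulrCA mulr_powRB1 ?ltW// mulrDl mul1r addrC.
pose g (t : R) : R^o := t * `|t| `^ q.
have cv : h^-1 *: (g (h *: (1 : R^o) + 0) - g 0) @[h --> (0 : R)^'] --> (0 : R^o).
  have : `|h| `^ q @[h --> (0 : R)^'] --> (0 : R).
    rewrite -[X in _ --> X](@powR0 R q) ?gt_eqF//.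
    apply: cvg_powR => //; last exact: cvg_cst.
    apply/cvgrPdist_le => e e0; near=> h.
    by rewrite sub0r normrN normr_id; near: h; exact: dnbhs0_le.
  apply: cvg_trans; apply: near_eq_cvg; near=> h.
  rewrite /g mul0r subr0 addr0 /GRing.scale /= mulr1 mulKf//.
  by near: h; exact: nbhs_dnbhs_neq.
rewrite normr0 powR0 ?gt_eqF// mulr0; apply: DeriveDef.
  by apply/cvg_ex; exists 0.
exact/cvg_lim.
Unshelve. all: by end_near. Qed.

Lemma mul_normr_powR (R : realType) (p u : R) : 2 < p ->
  u * (u * `|u| `^ (p - 2)) = `|u| `^ p.
Proof.
move=> p2; rewrite mulrA -expr2 -real_normK ?num_real// -powR_mulrn// -powRD.
  by rewrite addrC subrK.
by rewrite addrC subrK gt_eqF// (lt_trans _ p2).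
Qed.

Lemma is_derive_normr_powR (R : realType) (p u : R) : 2 < p ->
  is_derive u 1 (fun t => `|t| `^ p) (p * (u * `|u| `^ (p - 2))).
Proof.
move=> p2; have q0 : 0 < p - 2 by rewrite subr_gt0.
have -> : (fun t : R => `|t| `^ p) = (fun t => t * (t * `|t| `^ (p - 2))).
  by apply/funext => t; rewrite mul_normr_powR.
have := is_derive1M (@is_derive_id R R^o u 1) (is_derive_mul_normr_powR u q0).
by rewrite (_ : _ + _ = p * (u * `|u| `^ (p - 2)))//; ring.
Qed.

(** * Derivatives of the potential along great circles *)

Section Hessian.
Context {R : realType} {d : nat}.
Local Notation S := (sphere : set (borel_rV R d)).
Local Notation prob := (probability (borel_rV R d) R).
Implicit Types (p s : R) (x y v : 'rV[R]_d).

Definition geod x v s : 'rV[R]_d := cos s *: x + sin s *: v.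

Definition dgeod x v s : 'rV[R]_d := cos s *: v + (- sin s) *: x.

Lemma geodesic_unit x v s : enorm v = 1 -> geodesic x v s = geod x v s.
Proof. by move=> v1; rewrite /geodesic v1 mul1r divr1. Qed.

Lemma geod0 x v : geod x v 0 = x.
Proof. by rewrite /geod cos0 sin0 scale1r scale0r addr0. Qed.

Lemma dgeod0 x v : dgeod x v 0 = v.
Proof. by rewrite /dgeod cos0 sin0 oppr0 scale1r scale0r addr0. Qed.

Definition orthonormal_pair x v := [/\ dot x x = 1, dot v v = 1 & dot x v = 0].

Lemma orthonormal_geod x v s : orthonormal_pair x v ->
  orthonormal_pair (geod x v s) (dgeod x v s).
Proof.
move=> [x1 v1 xv]; have := cos2Dsin2 s.
rewrite /orthonormal_pair /geod /dgeod !(dotDl, dotDr, dotZl, dotZr) x1 v1 (dotC v x) xv.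
by move=> cs; split; [rewrite -[RHS]cs; ring|rewrite -[RHS]cs; ring|ring].
Qed.

Lemma is_derive_dot_geod x v y s :
  is_derive s 1 (fun t => dot (geod x v t) y) (dot (dgeod x v s) y).
Proof.
rewrite (_ : (fun t => _) = (fun t : R => cos t * dot x y + sin t * dot v y)).
  have H1 := is_derive1M (is_derive_cos s) (@is_derive_cst R R^o R^o (dot x y) s 1).
  have H2 := is_derive1M (is_derive_sin s) (@is_derive_cst R R^o R^o (dot v y) s 1).
  have := is_deriveD H1 H2.
  rewrite (_ : _ + _ = dot (dgeod x v s) y)//.
  by rewrite /dgeod dotDl !dotZl /=; ring.
by apply/funext => t; rewrite /geod dotDl !dotZl.
Qed.

Lemma is_derive_dot_dgeod x v y s :
  is_derive s 1 (fun t => dot (dgeod x v t) y) (- dot (geod x v s) y).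
Proof.
(* The velocity curve is itself the great circle from [v] with initial velocity [- x]. *)
rewrite (_ : (fun t => _) = (fun t : R => dot (geod v (- x) t) y)).
  have := is_derive_dot_geod v (- x) y s.
  rewrite (_ : dot (dgeod v (- x) s) y = - dot (geod x v s) y)//.
  by rewrite /geod /dgeod -[- x]scaleN1r !(dotDl, dotZl); ring.
by apply/funext => t; rewrite /geod /dgeod -[- x]scaleN1r !(dotDl, dotZl); ring.
Qed.

(** [grad_kernel] and [hess_kernel] are the first and second derivatives at [s = 0] of the kernel
    along [geod x v s]; the negative term of the second comes from the acceleration, which is minus
    the position. *)
Definition grad_kernel p x v y : R :=
  p * (dot x y * `|dot x y| `^ (p - 2)) * dot v y.

Definition hess_kernel p x v y : R :=
  p * (p - 1) * `|dot x y| `^ (p - 2) * dot v y ^+ 2 - p * `|dot x y| `^ p.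

Lemma is_derive_kernel_geod p x v y s : 2 < p ->
  is_derive s 1 (fun t => `|dot (geod x v t) y| `^ p)
    (grad_kernel p (geod x v s) (dgeod x v s) y).
Proof.
move=> p2; exact: (is_derive1_comp (is_derive_normr_powR _ p2)
  (is_derive_dot_geod x v y s)).
Qed.

Lemma is_derive_grad_kernel_geod p x v y s : 2 < p ->
  is_derive s 1 (fun t => grad_kernel p (geod x v t) (dgeod x v t) y)
    (hess_kernel p (geod x v s) (dgeod x v s) y).
Proof.
move=> p2; have q0 : 0 < p - 2 by rewrite subr_gt0.
have H1 := is_derive1_comp (is_derive_mul_normr_powR (dot (geod x v s) y) q0)
  (is_derive_dot_geod x v y s).
have H2 := is_derive1M (@is_derive_cst R R^o R^o p s 1) H1.
apply: (is_derive_eq (is_derive1M H2 (is_derive_dot_dgeod x v y s))).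
rewrite /hess_kernel -(mul_normr_powR _ p2) /=; ring.
Qed.

Context (U : set_system nat) {UU : UltraFilter U}.
Context (Ufree : forall N, U [set n | (N <= n)%N]).

Lemma is_derive_Rintegral (mu : prob) (f g : R -> 'rV[R]_d -> R) (B : R) :
  (forall s y, is_derive s 1 (f ^~ y) (g s y)) ->
  (forall s, sphere_cont U (f s)) ->
  (forall s y, sphere y -> `|g s y| <= B) ->
  forall s, is_derive s 1 (fun t => \int[mu]_(y in sphere) f t y)
    (\int[mu]_(y in sphere) g s y).
Proof.
move=> fg cf gB s.
have mS := @measurable_sphere R d.
have sI : `]s - 1, s + 1[%classic s.
  by rewrite /= in_itv /= ltrBlDr ltrDl ltr01.
have d1 : partial1of2 f = g.
  by apply/funext => t; apply/funext => y; rewrite partial1of2E derive_val.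
have intf t : (`]s - 1, s + 1[%classic : set R) t -> mu.-integrable S (EFin \o f t).
  by move=> _; exact: integrable_sphere_cont (cf t).
have derf t y : (`]s - 1, s + 1[%classic : set R) t -> S y -> derivable (f ^~ y) t 1.
  by move=> _ _; exact: ex_derive.
(* The absolute value makes the dominating constant nonnegative without assuming that the sphere is
   inhabited. *)
have B0 (y : borel_rV R d) : 0 <= `|B| by [].
have intB : mu.-integrable S (EFin \o (fun=> `|B|)).
  exact: finite_measure_integrable_cst.
have ub t y : (`]s - 1, s + 1[%classic : set R) t -> S y -> `|partial1of2 f t y| <= `|B|.
  by move=> _ yS; rewrite d1 (le_trans (gB t y yS))// ler_norm.
have H1 := derivable_under_integral mS sI intf derf B0 intB ub.
have H2 := differentiation_under_integral mS sI intf derf B0 intB ub.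
apply: DeriveDef => //.
by rewrite -derive1E H2 d1.
Qed.

Lemma grad_kernel_cvg (p_ : nat -> R) p (x_ v_ y_ : nat -> 'rV[R]_d) x v y :
  2 < p -> p_ n @[n --> U] --> p ->
  cvg_coord U x_ x -> cvg_coord U v_ v -> cvg_coord U y_ y ->
  grad_kernel (p_ n) (x_ n) (v_ n) (y_ n) @[n --> U] --> grad_kernel p x v y.
Proof.
move=> p2 pp xx vv yy; have xy := cvg_dot (UU := UU) xx yy.
have vy := cvg_dot (UU := UU) vv yy.
have xp : `|dot (x_ n) (y_ n)| `^ (p_ n - 2) @[n --> U] --> `|dot x y| `^ (p - 2).
  apply: cvg_powR => //; first by rewrite subr_gt0.
    by apply: cvg_norm; exact: cvg_dot.
  by apply: cvgB => //; exact: cvg_cst.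
exact: (cvgM (cvgM pp (cvgM xy xp)) vy).
Qed.

Lemma hess_kernel_cvg (p_ : nat -> R) p (x_ v_ y_ : nat -> 'rV[R]_d) x v y :
  2 < p -> p_ n @[n --> U] --> p ->
  cvg_coord U x_ x -> cvg_coord U v_ v -> cvg_coord U y_ y ->
  hess_kernel (p_ n) (x_ n) (v_ n) (y_ n) @[n --> U] --> hess_kernel p x v y.
Proof.
move=> p2 pp xx vv yy; have xy := cvg_dot (UU := UU) xx yy.
have vy := cvg_dot (UU := UU) vv yy.
have xp : `|dot (x_ n) (y_ n)| `^ (p_ n - 2) @[n --> U] --> `|dot x y| `^ (p - 2).
  apply: cvg_powR => //; first by rewrite subr_gt0.
    by apply: cvg_norm; exact: cvg_dot.
  by apply: cvgB => //; exact: cvg_cst.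
have xp' : `|dot (x_ n) (y_ n)| `^ p_ n @[n --> U] --> `|dot x y| `^ p.
  by apply: kernel_cvg => //; exact: lt_trans p2.
have pp1 : p_ n - 1 @[n --> U] --> p - 1 by apply: cvgB => //; exact: cvg_cst.
exact: (cvgB (cvgM (cvgM (cvgM pp pp1) xp) (cvgM vy vy)) (cvgM pp xp')).
Qed.

Lemma sphere_cont_grad_kernel p x v : 2 < p -> sphere_cont U (grad_kernel p x v).
Proof.
move=> p2 y_ y _ yy.
by apply: grad_kernel_cvg => //; [exact: cvg_cst|exact: cvg_coord_cst..].
Qed.

Lemma sphere_cont_hess_kernel p x v : 2 < p -> sphere_cont U (hess_kernel p x v).
Proof.
move=> p2 y_ y _ yy.
by apply: hess_kernel_cvg => //; [exact: cvg_cst|exact: cvg_coord_cst..].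
Qed.

Lemma powR_le1 (t q : R) : 0 <= t <= 1 -> 0 <= q -> t `^ q <= 1.
Proof.
move=> /andP[t0 t1] q0.
by rewrite (le_trans (ge0_ler_powR q0 _ _ t1)) ?nnegrE// powR1.
Qed.

Lemma grad_kernel_le p x v y : 2 < p -> dot x x = 1 -> dot v v = 1 ->
  sphere y -> `|grad_kernel p x v y| <= p.
Proof.
move=> p2 x1 v1 /sphereP y1; have p0 : 0 < p by exact: lt_trans p2.
have xy := dot_sphere_le1 x1 y1; have vy := dot_sphere_le1 v1 y1.
rewrite /grad_kernel !normrM (gtr0_norm p0) -mulrA ler_piMr ?(ltW p0)//.
rewrite mulr_ile1 ?mulr_ge0// mulr_ile1// ger0_norm ?powR_ge0// powR_le1 ?normr_ge0//.
by rewrite subr_ge0 ltW.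
Qed.

Lemma hess_kernel_le p x v y : 2 < p -> dot x x = 1 -> dot v v = 1 ->
  sphere y -> `|hess_kernel p x v y| <= p * (p - 1) + p.
Proof.
move=> p2 x1 v1 /sphereP y1; have p0 : 0 < p by exact: lt_trans p2.
have p10 : 0 < p - 1 by rewrite subr_gt0 (lt_trans _ p2)// ltr1n.
have xy := dot_sphere_le1 x1 y1; have vy := dot_sphere_le1 v1 y1.
rewrite /hess_kernel (le_trans (ler_normB _ _))// lerD//.
  rewrite !normrM (gtr0_norm p0) (gtr0_norm p10) -mulrA ler_piMr//.
    by rewrite ltW// mulr_gt0.
  rewrite mulr_ile1 ?mulr_ge0 ?mulr_ile1//.
  by rewrite ger0_norm ?powR_ge0// powR_le1 ?normr_ge0// subr_ge0 ltW.
rewrite normrM (gtr0_norm p0) ler_piMr ?(ltW p0)// ger0_norm ?powR_ge0//.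
by rewrite powR_le1 ?normr_ge0// ltW.
Qed.

Definition hess_form p (mu : prob) x v : R :=
  \int[mu]_(y in sphere) hess_kernel p x v y.

Definition grad_form p (mu : prob) x v : R :=
  \int[mu]_(y in sphere) grad_kernel p x v y.

Lemma is_derive_potential_geod p (mu : prob) x v s :
  2 < p -> orthonormal_pair x v ->
  is_derive s 1 (fun t => potential p mu (geod x v t))
    (grad_form p mu (geod x v s) (dgeod x v s)).
Proof.
move=> p2 xv; apply: (@is_derive_Rintegral mu
  (fun t y => `|dot (geod x v t) y| `^ p)
  (fun t => grad_kernel p (geod x v t) (dgeod x v t)) p).
- by move=> t y; exact: is_derive_kernel_geod.
- by move=> t; apply: sphere_cont_kernel; exact: lt_trans p2.
- move=> t y yS; have [g1 g2 _] := orthonormal_geod t xv.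
  exact: grad_kernel_le.
Qed.

Lemma is_derive_grad_form_geod p (mu : prob) x v s :
  2 < p -> orthonormal_pair x v ->
  is_derive s 1 (fun t => grad_form p mu (geod x v t) (dgeod x v t))
    (hess_form p mu (geod x v s) (dgeod x v s)).
Proof.
move=> p2 xv; apply: (@is_derive_Rintegral mu
  (fun t => grad_kernel p (geod x v t) (dgeod x v t))
  (fun t => hess_kernel p (geod x v t) (dgeod x v t)) (p * (p - 1) + p)).
- by move=> t y; exact: is_derive_grad_kernel_geod.
- by move=> t; exact: sphere_cont_grad_kernel.
- move=> t y yS; have [g1 g2 _] := orthonormal_geod t xv.
  exact: hess_kernel_le.
Qed.

Lemma HessE p (mu : prob) x v : 2 < p -> orthonormal_pair x v ->
  Hess (potential p mu) x v = hess_form p mu x v.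
Proof.
move=> p2 xv; have v1 : enorm v = 1 by case: xv => _ v1 _; rewrite /enorm v1 sqrtr1.
rewrite /Hess derive1nS derive1n1.
have -> : (fun s : R => potential p mu (geodesic x v s)) =
    (fun s => potential p mu (geod x v s)).
  by apply/funext => s; rewrite geodesic_unit.
have -> : derive1 (fun s => potential p mu (geod x v s)) =
    (fun s => grad_form p mu (geod x v s) (dgeod x v s)).
  apply/funext => s; rewrite derive1E.
  by have ? := is_derive_potential_geod mu s p2 xv; exact: derive_val.
rewrite derive1E -[in RHS](geod0 x v) -[in RHS](dgeod0 x v).
have ? := is_derive_grad_form_geod mu 0 p2 xv.
by rewrite derive_val !(geod0, dgeod0).
Qed.

Lemma hess_form_cvg (mu : nat -> prob) (nu : prob) (p_ : nat -> R) p
    (x_ v_ : nat -> 'rV[R]_d) x v :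
  weak_cvg U mu nu -> (forall n, 2 < p_ n) -> 2 < p ->
  p_ n @[n --> U] --> p -> cvg_coord U x_ x -> cvg_coord U v_ v ->
  hess_form (p_ n) (mu n) (x_ n) (v_ n) @[n --> U] --> hess_form p nu x v.
Proof.
move=> munu p_2 p2 pp xx vv; apply: (weak_ccvg Ufree munu).
- by move=> n; exact: sphere_cont_hess_kernel.
- exact: sphere_cont_hess_kernel.
- by move=> y_ y _ yy; exact: hess_kernel_cvg.
Qed.

End Hessian.

(** * Convex combinations of two probability measures *)

Section Mixture.
Context {dT : measure_display} {T : measurableType dT} {R : realType}.
Context (P Q : probability T R) (t : R) (t0 : 0 <= t) (t1 : 0 <= 1 - t).

Definition mixture : set T -> \bar R :=
  measure_add (mscale (NngNum t1) P) (mscale (NngNum t0) Q).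

HB.instance Definition _ := Measure.on mixture.

Lemma mixture_setT : mixture setT = 1%E.
Proof.
rewrite /mixture measure_addE.
transitivity ((1 - t)%:E * P setT + t%:E * Q setT)%E => //.
by rewrite !probability_setT !mule1 -EFinD subrK.
Qed.

HB.instance Definition _ := Measure_isProbability.Build _ _ _ mixture mixture_setT.

Lemma mixtureE A : mixture A = ((1 - t)%:E * P A + t%:E * Q A)%E.
Proof. by rewrite /mixture measure_addE. Qed.

Lemma Rintegral_mixture (D : set T) (f : T -> R) : measurable D ->
  (forall x, D x -> 0 <= f x) ->
  P.-integrable D (EFin \o f) -> Q.-integrable D (EFin \o f) ->
  \int[mixture]_(x in D) f x =
  (1 - t) * \int[P]_(x in D) f x + t * \int[Q]_(x in D) f x.
Proof.
move=> mD f0 Pf Qf; have mf := measurable_int _ Pf.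
have f0' x : D x -> (0 <= (EFin \o f) x)%E by move=> /f0; rewrite lee_fin.
have PI := integrable_fin_num mD Pf.
have QI := integrable_fin_num mD Qf.
rewrite /Rintegral ge0_integral_measure_add// !ge0_integral_mscale//=.
by rewrite fineD ?fin_numM// !fineM.
Qed.

End Mixture.

(** * First variation of the energy at a minimizer *)

Section Minimizers.
Context {R : realType} {d : nat}.
Local Notation S := (sphere : set (borel_rV R d)).
Local Notation prob := (probability (borel_rV R d) R).
Implicit Types (p s e : R) (x y v z : 'rV[R]_d) (mu : prob).
Context (U : set_system nat) {UU : UltraFilter U}.
Context (Ufree : forall N, U [set n | (N <= n)%N]).

Lemma potential_ge0 p mu x : 0 <= potential p mu x.
Proof. by apply: Rintegral_ge0 => y _; exact: powR_ge0. Qed.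

(* First-order condition for the competitor [(1 - t) mu + t delta_x]. *)
Lemma potential_minimizer p mu x : 0 < p -> minimizers p mu -> sphere x ->
  min_energy d p <= potential p mu x.
Proof.
move=> p0 [muS emu] xS; rewrite -emu; set I := energy p mu.
have mS := @measurable_sphere R d.
set F := potential p mu x.
have [//|FI] := leP I F.
(* The competitor has energy [I - 2 * t * D + t ^+ 2 * (I - 2 * F + 1)]. Since [K] bounds the last
   coefficient and [t = D / (D + K)] gives [t * K < D], this would be less than [I]. *)
pose K := `|I - 2 * F + 1| + 1.
have K0 : 0 < K by rewrite ltr_wpDl.
pose D := I - F; have D0 : 0 < D by rewrite subr_gt0.
pose t := D / (D + K).
have DK0 : 0 < D + K by rewrite addr_gt0.
have t0 : 0 < t by rewrite divr_gt0.
have t1 : 0 <= 1 - t by rewrite subr_ge0 ler_pdivrMr// mul1r lerDl ltW.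
pose dx : prob := @dirac _ (borel_rV R d) x R.
have dxS : dx S = 1%E by rewrite /dx /= diracE mem_set.
pose nu : prob := mixture mu dx (ltW t0) t1.
have nuS : sphere_prob nu.
  by rewrite /sphere_prob /= mixtureE muS dxS !mule1 -EFinD subrK.
have nuI f : sphere_cont U f -> (forall y, sphere y -> 0 <= f y) ->
    \int[nu]_(y in sphere) f y = (1 - t) * \int[mu]_(y in sphere) f y + t * f x.
  move=> cf f0; rewrite Rintegral_mixture//; last 2 first.
  - exact: integrable_sphere_cont cf.
  - exact: integrable_sphere_cont cf.
  congr (_ + t * _); rewrite /Rintegral [X in fine X]integral_dirac//.
    by rewrite [\d__ _]dxS mul1e.
  apply/measurable_EFinP; exact: measurable_sphere_cont cf.
have potE z : potential p nu z = (1 - t) * potential p mu z + t * `|dot z x| `^ p.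
  apply: (nuI (fun y => `|dot z y| `^ p)); first exact: sphere_cont_kernel.
  by move=> y _; exact: powR_ge0.
have muint : \int[mu]_(z in sphere) potential p nu z = (1 - t) * I + t * F.
  have -> : \int[mu]_(z in sphere) potential p nu z =
      \int[mu]_(z in sphere) ((1 - t) * potential p mu z + t * `|dot x z| `^ p).
    by apply: eq_Rintegral => z _; rewrite potE (dotC z).
  have i1 : mu.-integrable S (EFin \o potential p mu).
    by apply: integrable_sphere_cont => //; exact: sphere_cont_potential.
  have i2 : mu.-integrable S (EFin \o (fun z => `|dot x z| `^ p)).
    by apply: integrable_sphere_cont => //; exact: sphere_cont_kernel.
  have j1 := integrableZl mS (1 - t) i1.
  have j2 := integrableZl mS t i2.
  by rewrite (RintegralD mS j1 j2) !RintegralZl.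
have xx1 : `|dot x x| `^ p = 1.
  by rewrite ((sphereP x).1 xS) normr1 powR1.
have : I <= energy p nu by rewrite /I emu; exact: min_energy_le.
rewrite /energy -/(potential _ _ _) nuI; last 2 first.
- exact: sphere_cont_potential.
- by move=> y _; exact: potential_ge0.
rewrite -/(potential _ _ _) muint potE xx1 -/F => H.
have tK : t * K < D.
  by rewrite mulrAC ltr_pdivrMr// ltr_pM2l// ltrDr.
have MK : I - 2 * F + 1 <= K by rewrite (le_trans (ler_norm _))// lerDl.
have : 2 * D <= t * (I - 2 * F + 1).
  rewrite -(ler_pM2l t0).
  have -> : t * (t * (I - 2 * F + 1)) = (1 - t) * ((1 - t) * I + t * F) +
     t * ((1 - t) * F + t * 1) - I + t * (2 * D) by rewrite /D; ring.
  by rewrite lerDr subr_ge0.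
have : t * (I - 2 * F + 1) <= t * K by rewrite ler_pM2l.
by move=> ? ?; exfalso; lra.
Qed.

End Minimizers.

(** * The support lies in the contact set *)

Section Contact.
Context {R : realType} {d : nat}.
Local Notation S := (sphere : set (borel_rV R d)).
Local Notation prob := (probability (borel_rV R d) R).
Implicit Types (p s e : R) (x y v z : 'rV[R]_d) (mu : prob).
Context (U : set_system nat) {UU : UltraFilter U}.
Context (Ufree : forall N, U [set n | (N <= n)%N]).

Lemma cvg_harmonic_dist (u w : nat -> R) (l : R) :
  w n @[n --> U] --> l -> (forall n, `|u n - w n| < n.+1%:R^-1) ->
  u n @[n --> U] --> l.
Proof.
move=> wl uw.
have -> : u = (fun n => (u n - w n) + w n) by apply/funext => n; rewrite subrK.
rewrite -[l]add0r; apply: cvgD => //; apply/cvgrPdist_lt => e e0.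
have /cvgrPdist_lt/(_ _ e0)[N _ NP] := @cvg_harmonic R.
apply: filterS (Ufree N) => n /= /NP.
rewrite /= !sub0r !normrN (ger0_norm (harmonic_ge0 _)).
exact: lt_trans.
Qed.

(** Failure at every radius 1/(n+1) would give a sequence tending to [x] along which [f] stays away
    from [f x]. *)
Lemma sphere_cont_near f x e : sphere_cont U f -> sphere x -> 0 < e ->
  exists2 r : R, 0 < r & forall z, sphere z -> ball x r z -> `|f z - f x| < e.
Proof.
move=> cf xS e0; apply: contrapT => H.
have /choice[z_ zP] n : exists z, [/\ sphere z, ball x n.+1%:R^-1 z & e <= `|f z - f x|].
  apply: contrapT => N; apply: H; exists n.+1%:R^-1 => // z zS zx.
  by rewrite ltNge; apply/negP => ez; apply: N; exists z.
have zx : cvg_coord U z_ x.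
  move=> i; apply: (@cvg_harmonic_dist _ (fun=> x 0 i)); first exact: cvg_cst.
  move=> n; have [_ [_ xz] _] := zP n.
  by have := xz 0 i; rewrite /ball /= distrC.
have /cvgrPdist_lt/(_ _ e0) : f (z_ n) @[n --> U] --> f x.
  by apply: cf => // n; case: (zP n).
move=> /filter_ex[n]; case: (zP n) => _ _; rewrite distrC leNgt => /negP; exact.
Qed.

Lemma msupport_sphere mu : sphere_prob mu -> msupport mu `<=` sphere.
Proof.
move=> muS x xsupp; apply: contrapT => xS.
have oS : open (~` (@sphere R d)) by rewrite openC; exact: closed_sphere.
have := xsupp _ oS xS; rewrite (_ : mu _ = 0%E) ?ltxx//.
by rewrite [LHS](probability_setC mu (@measurable_sphere R d)) muS subee.
Qed.

(** The energy is the mean of the potential, which is at least [E] on the sphere. An excess at a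
    support point would persist on a ball of positive mass and push the mean above [E]. *)
Lemma msupport_contact p mu : 0 < p -> minimizers p mu ->
  msupport mu `<=` contact_set p mu.
Proof.
move=> p0 mumin x xsupp; have [muS emu] := mumin.
have xS := msupport_sphere muS xsupp.
have mS := @measurable_sphere R d.
split=> //; apply/eqP; rewrite eq_le (potential_minimizer Ufree)// andbT.
rewrite leNgt; apply/negP => Fx; set F := potential p mu in Fx *.
set E := min_energy d p in Fx *.
(* Half of the excess: within [eta] of [F x], the potential is still at least [E + eta]. *)
pose eta := (F x - E) / 2.
have eta0 : 0 < eta by rewrite divr_gt0// subr_gt0.
have cF : sphere_cont U F by exact: sphere_cont_potential.
have [r r0 rF] := sphere_cont_near cF xS eta0.
have oB : open (ball x r) by exact: ball_open.
have muB := xsupp _ oB (ballxx x r0).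
have mB : measurable (ball x r : set (borel_rV R d)) by exact: open_measurable_rV.
have muBS : mu (ball x r `&` S) = mu (ball x r).
  rewrite [RHS](measureDI mu mB mS) -[LHS]add0e; congr (_ + _)%E.
  have muSC : mu (~` S) = 0%E by rewrite probability_setC// muS subee.
  apply/esym/eqP; rewrite -measure_le0 -muSC le_measure ?inE//.
  - exact: measurableD.
  - exact: measurableC.
pose B : set (borel_rV R d) := ball x r.
have muB0 : 0 < fine (mu (B `&` S)).
  by rewrite fine_gt0// muBS muB -ge0_fin_numE// fin_num_measure.
have i1 : mu.-integrable S (EFin \o F) by exact: integrable_sphere_cont cF.
have i2 : mu.-integrable S (EFin \o (fun y : borel_rV R d => \1_B y)).
  by apply: (integrableS measurableT) => //; exact: integrable_indic.
have i3 := integrableZl mS eta i2.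
have i4 : mu.-integrable S (EFin \o cst E) by exact: finite_measure_integrable_cst.
have i5 : mu.-integrable S (EFin \o (fun y : borel_rV R d => E + eta * \1_B y)).
  exact: (integrableD mS i4 i3).
have : \int[mu]_(y in S) (E + eta * \1_B y) <= \int[mu]_(y in S) F y.
  apply: (le_Rintegral mS i5 i1) => z zS; rewrite indicE.
  have [/set_mem zB|_] := boolP (z \in B); last first.
    by rewrite mulr0 addr0; exact: (potential_minimizer Ufree p0 mumin zS).
  have := rF z zS zB; rewrite ltr_norml mulr1 => /andP[+ _].
  rewrite ltrBrDr => /ltW; apply: le_trans.
  have -> : F x = E + eta + eta by rewrite /eta -addrA -splitr addrC subrK.
  by rewrite [leRHS]addrC addrK.
have cE : \int[mu]_(y in S) cst E y = E.
  have mu1 : fine (mu S) = 1 by rewrite (muS : mu S = 1%E).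
  exact: etrans (Rintegral_cst mu mS E) (etrans (congr1 ( *%R E) mu1) (mulr1 E)).
rewrite (RintegralD mS i4 i3) RintegralZl// cE.
have -> : \int[mu]_(y in S) \1_B y = fine (mu (B `&` S)).
  by rewrite /Rintegral integral_indic.
rewrite -[X in _ <= X -> _]/(energy p mu) emu -/E leNgt => /negP; apply.
by rewrite ltrDl mulr_gt0.
Qed.

End Contact.

(** * Uniform Hessian bound and separation of contact points *)

Section Finiteness.
Context {R : realType} {d : nat}.
Local Notation prob := (probability (borel_rV R d) R).
Implicit Types (p s e : R) (x y v z : 'rV[R]_d) (mu : prob).
Context (U : set_system nat) {UU : UltraFilter U}.
Context (Ufree : forall N, U [set n | (N <= n)%N]).

(* The point [z] at which the Hessian is bounded below is only required to be
   close to a contact point: this makes the bound usable at the intermediate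
   point produced by Rolle's theorem between two contact points. *)
Lemma hess_form_lower_bound (p0 : R) : 2 < p0 ->
  (forall (nu : prob) x, minimizers p0 nu -> contact_set p0 nu x ->
     Hess_posdef (potential p0 nu) x) ->
  exists2 e : R, 0 < e & forall p mu x z v,
    `|p - p0| < e -> minimizers p mu -> contact_set p mu x ->
    (forall i, `|z 0 i - x 0 i| < e) -> orthonormal_pair z v ->
    e <= hess_form p mu z v.
Proof.
move=> p02 Hpos; apply: contrapT => H.
(* The cap [p0 - 2] keeps every exponent [p_ n] above 2. *)
pose e n : R := Num.min n.+1%:R^-1 (p0 - 2).
have e0 n : 0 < e n by rewrite lt_min invr_gt0 ltr0n subr_gt0.
have /choice[w wP] n : exists w : R * prob * 'rV[R]_d * 'rV[R]_d * 'rV[R]_d,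
    let: (p, mu, x, z, v) := w in
    [/\ `|p - p0| < e n, minimizers p mu, contact_set p mu x,
        (forall i, `|z 0 i - x 0 i| < e n) /\ orthonormal_pair z v &
        hess_form p mu z v < e n].
  apply: contrapT => N; apply: H; exists (e n) => // p mu x z v pe mumin xc zx zv.
  by rewrite leNgt; apply/negP => he; apply: N; exists (p, mu, x, z, v).
pose p_ n := (w n).1.1.1.1; pose mu_ n := (w n).1.1.1.2.
pose x_ n := (w n).1.1.2; pose z_ n := (w n).1.2; pose v_ n := (w n).2.
have {}wP n : [/\ `|p_ n - p0| < e n, minimizers (p_ n) (mu_ n),
    contact_set (p_ n) (mu_ n) (x_ n),
    (forall i, `|z_ n 0 i - x_ n 0 i| < e n) /\ orthonormal_pair (z_ n) (v_ n) &
    hess_form (p_ n) (mu_ n) (z_ n) (v_ n) < e n].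
  by have := wP n; rewrite /p_ /mu_ /x_ /z_ /v_; case: (w n) => [[[[]]]].
have en n : e n <= n.+1%:R^-1 by rewrite ge_min lexx.
have p_2 n : 2 < p_ n.
  have [+ _ _ _ _] := wP n; rewrite lt_min => /andP[_]; rewrite ltr_norml => /andP[+ _].
  by rewrite opprB ltrBrDr subrK.
have p_0 n : 0 < p_ n by exact: lt_trans (p_2 n).
have p00 : 0 < p0 by exact: lt_trans p02.
have pp : p_ n @[n --> U] --> p0.
  apply: (cvg_harmonic_dist Ufree (cvg_cst p0)) => n.
  by have [h _ _ _ _] := wP n; exact: lt_le_trans h (en n).
have zS n : sphere (z_ n) by apply/sphereP; have [_ _ _ [_ []]] := wP n.
have vS n : sphere (v_ n) by apply/sphereP; have [_ _ _ [_ []]] := wP n.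
have [z zS' zz] := sphere_ultra (UU := UU) zS.
have [v vS' vv] := sphere_ultra (UU := UU) vS.
(* The contact points [x_ n] have the same limit as the points [z_ n], which makes [z] a contact
   point of the limit measure. *)
have xz : cvg_coord U x_ z.
  move=> i; apply: (cvg_harmonic_dist Ufree (zz i)) => n.
  by rewrite distrC; have [_ _ _ [h _] _] := wP n; exact: lt_le_trans (h i) (en n).
have mumin n : minimizers (p_ n) (mu_ n) by case: (wP n).
have [nu nuS munu] := weak_compact (UU := UU) Ufree (fun n => proj1 (mumin n)).
have [numin ee] := minimizers_cvg (UU := UU) Ufree munu nuS p_0 p00 pp mumin.
have zc : contact_set p0 nu z.
  split=> //; have H1 := potential_cvg (UU := UU) Ufree munu p_0 p00 pp xz.
  have xE : (fun n => potential (p_ n) (mu_ n) (x_ n)) = (fun n => min_energy d (p_ n)).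
    by apply/funext => n; have [_ _ []] := wP n.
  by move: H1; rewrite xE => H1; exact: (cvg_unique _ H1 ee).
have zv : dot z v = 0.
  have zvE : (fun n => dot (z_ n) (v_ n)) = (fun=> 0).
    by apply/funext => n; have [_ _ _ [_ []]] := wP n.
  have := cvg_dot (UU := UU) zz vv; rewrite zvE => H1.
  exact: (cvg_unique _ H1 (cvg_cst 0)).
have zvO : orthonormal_pair z v by split=> //; exact/sphereP.
have v0 : v != 0.
  by apply/eqP => v0; move: vS'; rewrite v0; exact: sphere0.
have := Hpos nu z numin zc v zv v0; rewrite (HessE (UU := UU) Ufree)//.
rewrite ltNge => /negP; apply.
have hc := hess_form_cvg (UU := UU) Ufree munu p_2 p02 pp zz vv.
have ec : e n @[n --> U] --> 0.
  apply/cvgrPdist_lt => r r0.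
  have /cvgrPdist_lt/(_ _ r0)[N _ NP] := @cvg_harmonic R.
  apply: filterS (Ufree N) => n /= /NP.
  rewrite /= !sub0r !normrN (ger0_norm (harmonic_ge0 _)) (gtr0_norm (e0 n)).
  exact: le_lt_trans.
apply: (cvg_le_filter hc ec) => n.
by have [_ _ _ _ /ltW] := wP n.
Qed.

(** The right-hand side is the squared Euclidean distance of two unit vectors, of which each squared
    coordinate difference is one term. *)
Lemma dot_sub_sqr x y : dot x x = 1 -> dot y y = 1 ->
  forall i, (x 0 i - y 0 i) ^+ 2 <= 2 - 2 * dot x y.
Proof.
move=> x1 y1 i.
have -> : 2 - 2 * dot x y = \sum_(j < d) (x 0 j - y 0 j) ^+ 2.
  rewrite (_ : 2 - 2 * dot x y = dot x x + dot y y - 2 * dot x y).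
    rewrite /dot mulr_sumr -big_split /= -sumrB; apply: eq_bigr => j _.
    by ring.
  by rewrite x1 y1.
rewrite (bigD1 i)//= lerDl; apply: sumr_ge0 => j _; exact: sqr_ge0.
Qed.

Lemma mem_itv_pm1 s : s - 1 <= s + 1 /\ s \in `](s - 1), (s + 1)[.
Proof. by rewrite in_itv /=; split; [lra|apply/andP; split; lra]. Qed.

Lemma dot_geod x v s : orthonormal_pair x v -> dot x (geod x v s) = cos s.
Proof.
by move=> [x1 _ xv]; rewrite /geod dotDr !dotZr x1 xv mulr0 addr0 mulr1.
Qed.

Lemma hess_form_zero_between p mu x y : 2 < p -> minimizers p mu ->
  contact_set p mu x -> contact_set p mu y -> x != y -> -1 < dot x y ->
  exists z v, [/\ orthonormal_pair z v, dot x y <= dot x z &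
    hess_form p mu z v = 0].
Proof.
move=> p2 mumin [xS xe] [yS ye] xy xyN1.
have p0 : 0 < p by exact: lt_trans p2.
have x1 := (sphereP x).1 xS; have y1 := (sphereP y).1 yS.
set c := dot x y in xyN1 *.
have c1 : c < 1.
  rewrite ltNge; apply/negP => c1; move/eqP: xy; apply.
  apply/rowP => i; apply/eqP; rewrite -subr_eq0 -sqrf_eq0 eq_le sqr_ge0 andbT.
  by rewrite (le_trans (dot_sub_sqr x1 y1 i))// -/c subr_le0 ler_pMr.
have c11 : -1 <= c <= 1 by rewrite !ltW.
set th := acos c.
have th0 : 0 < th by apply: acos_gt0; rewrite ltW.
have thpi : th < pi by apply: acos_ltpi; rewrite xyN1 ltW.
have costh : cos th = c by apply: acosK; rewrite in_itv.
have sinth : 0 < sin th by apply: sin_gt0_pi; rewrite th0.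
have sin2 : sin th * sin th = 1 - c ^+ 2 by rewrite -expr2 sin2cos2 costh.
(* Gram-Schmidt: the component of [y] orthogonal to [x] has norm [sin th], which is nonzero because
   [x] and [y] are neither equal nor antipodal. *)
pose v := (sin th)^-1 *: (y + (- c) *: x).
have xv : orthonormal_pair x v.
  rewrite /orthonormal_pair /v !(dotDl, dotDr, dotZl, dotZr) x1 y1 (dotC y x) -/c.
  split=> //; last by ring.
  transitivity ((sin th)^-1 * (sin th)^-1 * (1 - c ^+ 2)); first by ring.
  by rewrite -sin2 mulrACA mulVf ?gt_eqF// mulr1.
have gth : geod x v th = y.
  rewrite /geod costh /v scalerA divff ?gt_eqF// scale1r addrC -addrA.
  by rewrite -scalerDl addNr scale0r addr0.
pose phi s := potential p mu (geod x v s).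
pose G s := grad_form p mu (geod x v s) (dgeod x v s).
have dphi s : is_derive s 1 phi (G s) by exact: (is_derive_potential_geod Ufree).
have dG s : is_derive s 1 G (hess_form p mu (geod x v s) (dgeod x v s)).
  exact: (is_derive_grad_form_geod Ufree).
have phi_min s : min_energy d p <= phi s.
  apply: (potential_minimizer Ufree) => //.
  by apply/sphereP; case: (orthonormal_geod s xv).
(* The great circle stays on the sphere, where the potential is at least the minimal energy, so it
   has a critical point wherever it meets the contact set. *)
have Gmin s : phi s = min_energy d p -> G s = 0.
  move=> phis.
  have H : is_derive s 1 phi 0.
    apply: (@derive1_at_min _ phi (s - 1) (s + 1)).
    - exact: proj1 (mem_itv_pm1 s).
    - by move=> t _; case: (dphi t).
    - exact: proj2 (mem_itv_pm1 s).
    - by move=> t _; rewrite phis.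
  by rewrite -(@derive_val _ _ _ _ _ _ _ (dphi s)) (@derive_val _ _ _ _ _ _ _ H).
have G0 : G 0 = 0 by apply: Gmin; rewrite /phi geod0.
have Gth : G th = 0 by apply: Gmin; rewrite /phi gth.
have [|||xi xith Gxi] := @Rolle _ G 0 th th0.
- by move=> t _; case: (dG t).
- apply: derivable_within_continuous => t _.
  by case: (dG t).
- by rewrite G0 Gth.
move: xith; rewrite in_itv /= => /andP[xi0 xith].
exists (geod x v xi), (dgeod x v xi); split.
- exact: orthonormal_geod.
(* [xi] lies before [th] and the cosine decreases on [[0, pi]]. *)
- rewrite (dot_geod xi xv) -costh ltW//.
  by rewrite ltr_cos// in_itv /= !ltW// (lt_trans xith).
- by rewrite -(@derive_val _ _ _ _ _ _ _ (dG xi)) (@derive_val _ _ _ _ _ _ _ Gxi).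
Qed.

(** Pairs violating the bound at every level would share a limit [x], and then
    [dot x x <= 1 - e]. *)
Lemma code_sphere_close e : 0 < e -> exists k, forall x y,
  sphere x -> sphere y -> code k x = code k y -> 1 - e < dot x y.
Proof.
move=> e0; apply: contrapT => /forallNP H.
have /choice[w wP] k : exists w : 'rV[R]_d * 'rV[R]_d,
    [/\ sphere w.1, sphere w.2, code k w.1 = code k w.2 & dot w.1 w.2 <= 1 - e].
  apply: contrapT => N; apply: (H k) => x y xS yS xy.
  by rewrite ltNge; apply/negP => exy; apply: N; exists (x, y).
have xS n : sphere (w n).1 by case: (wP n).
have yS n : sphere (w n).2 by case: (wP n).
have [x xS' xx] := sphere_ultra (UU := UU) xS.
have [y yS' yy] := sphere_ultra (UU := UU) yS.
have xy : x = y.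
  by apply: (cvg_code_eq Ufree _ xx yy) => n; case: (wP n).
have : dot x y <= 1 - e.
  apply: (cvg_le_filter (cvg_dot (UU := UU) xx yy) (cvg_cst (1 - e))) => n.
  by case: (wP n).
by rewrite -xy ((sphereP x).1 xS') lerDl oppr_ge0 leNgt e0.
Qed.

End Finiteness.

(** * Choice of the constants and counting of the support *)

Unset Implicit Arguments.

Theorem theorem1p3 (R : realType) (d : nat) (p0 : R) :
  (2 <= d)%N -> 2 < p0 ->
  (forall (nu : probability (borel_rV R d) R) (x : 'rV[R]_d),
      minimizers p0 nu -> contact_set p0 nu x ->
      Hess_posdef (potential p0 nu) x) ->
  exists (delta h : R) (N : nat),
    [/\ 0 < delta, 0 < h &
     forall (p : R) (mu : probability (borel_rV R d) R),
       `|p - p0| < delta -> minimizers p mu ->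
       (forall x : 'rV[R]_d, contact_set p mu x ->
          Hess_ge (potential p mu) x h) /\
       (msupport mu #<= `I_N)%card].
Proof.
move=> _ p02 Hpos.
(* An ultrafilter finer than the eventual filter on [nat] is free. *)
have [U [UU Uoo]] := ultraFilterLemma eventually_filter.
have Ufree N : U [set n | (N <= n)%N] by apply: Uoo; exists N.
have [e e0 He] := hess_form_lower_bound (UU := UU) Ufree p02 Hpos.
(* With [dot x y > 1 - r], the bound [r <= 1] excludes antipodal points and [2 * r <= e ^+ 2] bounds
   the squared distance by [e ^+ 2]. *)
pose r := Num.min 1 (e ^+ 2 / 2).
have r0 : 0 < r by rewrite lt_min ltr01 divr_gt0 ?exprn_gt0.
have r1 : r <= 1 by rewrite ge_min lexx.
have re : 2 * r <= e ^+ 2.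
  by rewrite mulrC -ler_pdivlMr// ge_min lexx orbT.
have [k kP] := code_sphere_close (UU := UU) (d := d) Ufree r0.
(* The term [p0 - 2] forces [p > 2]; [2 ^ k] is the number of possible codes of level [k], and
   [code k] will be injective on the support. *)
exists (Num.min e (p0 - 2)), e, (2 ^ k)%N; split=> // [|p mu].
  by rewrite lt_min e0 subr_gt0.
rewrite lt_min => /andP[pe pp2] mumin.
have p2 : 2 < p.
  by move: pp2; rewrite ltr_norml => /andP[+ _]; rewrite opprB ltrBrDr subrK.
have p_gt0 : 0 < p by exact: lt_trans p2.
split=> [x xc v xv v1|].
  have xvO : orthonormal_pair x v.
    by split=> //; apply/sphereP => //; case: xc.
  rewrite (HessE (UU := UU) Ufree)//; apply: (He p mu x x) => // i.
  by rewrite subrr normr0.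
have close x y : msupport mu x -> msupport mu y -> code k x = code k y -> x = y.
  move=> xs ys xy; apply/eqP/negP => /negP xney.
  have xc := msupport_contact (UU := UU) Ufree p_gt0 mumin xs.
  have yc := msupport_contact (UU := UU) Ufree p_gt0 mumin ys.
  have rxy := kP x y (proj1 xc) (proj1 yc) xy.
  have [xyN1 xye] : -1 < dot x y /\ 2 - 2 * dot x y < e ^+ 2.
    by move: r1 re rxy; clear; split; lra.
  have [z [v [zv xyz hz]]] :=
    hess_form_zero_between (UU := UU) Ufree p2 mumin xc yc xney xyN1.
  have [z1 _ _] := zv.
  have := He p mu x z v pe mumin xc _ zv; rewrite hz leNgt e0 => /(_ _)/negP.
  (* The intermediate point [z] is at least as close to [x] as [y] is, so the lower bound [e] on the
     Hessian applies at [z], where it vanishes. *)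
  apply => // i; rewrite -(@ltr_sqr _ `|z 0 i - x 0 i| e) ?nnegrE ?(ltW e0)//.
  rewrite real_normK ?num_real//.
  apply: (le_lt_trans (dot_sub_sqr z1 ((sphereP x).1 (proj1 xc)) i)).
  by apply: le_lt_trans xye; rewrite dotC lerD2l lerN2 ler_pM2l.
have : {in msupport mu &, injective (@code R d k)}.
  by move=> x y; rewrite !inE => xs ys; exact: close.
move=> /inj_card_eq; rewrite card_eq_le => /andP[_ /card_le_trans]; apply.
by apply: subset_card_le => _ [x _ <-]; exact: code_lt.
Qed.
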